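(* Let $K$ be a field and $A$ a finite-dimensional $K$-algebra. If a semibrick $\mathcal S$ in $\operatorname{mod} A$ is either left finite or right finite, then $\#\mathcal S\le n_A$, where $n_A$ is the number of isoclasses of simple $A$-modules.
   Context: $\operatorname{mod} A$ is the category of finite-dimensional right $A$-modules. A brick is a module $S\in\operatorname{mod} A$ with $\operatorname{End}_A(S)$ a division algebra. A semibrick is a (possibly infinite) set $\mathcal S$ of isoclasses of bricks with $\operatorname{Hom}_A(S_1,S_2)=0$ for all $S_1\neq S_2$ in $\mathcal S$. A torsion class (resp. torsion-free class) is a full subcategory of $\operatorname{mod} A$ closed under extensions and factor modules (resp. extensions and submodules). $\mathsf T(\mathcal S)$ (resp. $\mathsf F(\mathcal S)$) is the smallest torsion class (resp. torsion-free class) containing $\mathcal S$. The semibrick $\mathcal S$ is left finite if $\mathsf T(\mathcal S)$ is functorially finite in $\operatorname{mod} A$, and right finite if $\mathsf F(\mathcal S)$ is functorially finite in $\operatorname{mod} A$. *)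

(* Defs.v *)
From HB Require Import structures.
From mathcomp Require Import all_boot all_algebra all_field.
From mathcomp Require Import boolp classical_sets.
Set Implicit Arguments.
Unset Strict Implicit.
Unset Printing Implicit Defensive.
Import GRing.Theory.
Local Open Scope ring_scope.
Local Open Scope classical_set_scope.

(* Finite-dimensional right A-modules, i.e. the objects of mod A. *)
Record rmod (K : fieldType) (A : falgType K) := RMod {
  rmod_space :> vectType K;
  ract : rmod_space -> A -> rmod_space;
  ractDl : forall x y a, ract (x + y) a = ract x a + ract y a;
  ractDr : forall x a b, ract x (a + b) = ract x a + ract x b;
  ractZl : forall (k : K) x a, ract (k *: x) a = k *: ract x a;
  ractZr : forall (k : K) x a, ract x (k *: a) = k *: ract x a;
  ractM : forall x a b, ract x (a * b) = ract (ract x a) b;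
  ract1 : forall x, ract x 1 = x
}.

(* Classes of modules (full subcategories given by their objects, isoclasses)
   are Prop-valued predicates: universe constraints prevent rmod A from being
   the argument of the type constructor set. *)
Definition modclass (K : fieldType) (A : falgType K) := rmod A -> Prop.

Section ModuleCategory.
Context {K : fieldType} {A : falgType K}.
Implicit Types (L M N X Y Z : rmod A) (C : modclass A) (S : modclass A -> Prop).

Definition Hom_mod M N (f : 'Hom(M, N)) : Prop :=
  forall x a, f (ract x a) = ract (f x) a.

Definition isomorphic M N : Prop :=
  exists (f : 'Hom(M, N)) (g : 'Hom(N, M)),
    [/\ Hom_mod f, Hom_mod g, (g \o f = \1)%VF & (f \o g = \1)%VF].

Definition isoclass M : modclass A := fun N => isomorphic M N.

Definition isoclasses C : modclass A -> Prop :=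
  fun c => exists2 M, C M & c = isoclass M.

(* S is a finite set of cardinal n. *)
Definition has_card S (n : nat) : Prop :=
  exists F : 'I_n -> modclass A,
    (forall i j, F i = F j -> i = j) /\ (forall c, S c <-> exists i, c = F i).

Definition submodule M (U : {vspace M}) : Prop :=
  forall x a, x \in U -> ract x a \in U.

Definition simple_module M : Prop :=
  (fullv : {vspace M}) <> 0%VS /\
  forall U : {vspace M}, submodule U -> U = 0%VS \/ U = fullv.

(* End_A(M) is a division algebra; the first clause says 1 <> 0 in it. *)
Definition brick M : Prop :=
  (\1%VF : 'End(M)) <> 0 /\
  forall f : 'End(M), Hom_mod f -> f <> 0 ->
    exists g : 'End(M), [/\ Hom_mod g, (g \o f = \1)%VF & (f \o g = \1)%VF].

Definition semibrick S : Prop :=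
  (forall c, S c -> isoclasses brick c) /\
  forall M N, S (isoclass M) -> S (isoclass N) -> isoclass M <> isoclass N ->
    forall f : 'Hom(M, N), Hom_mod f -> f = 0.

Definition closed_extensions C : Prop :=
  forall L M N (f : 'Hom(L, M)) (g : 'Hom(M, N)),
    Hom_mod f -> Hom_mod g ->
    lker f = 0%VS -> limg f = lker g -> limg g = fullv ->
    C L -> C N -> C M.

(* Closure under isomorphism is included, as g may be an isomorphism. *)
Definition closed_factors C : Prop :=
  forall M N (g : 'Hom(M, N)), Hom_mod g -> limg g = fullv -> C M -> C N.

Definition closed_submodules C : Prop :=
  forall L M (f : 'Hom(L, M)), Hom_mod f -> lker f = 0%VS -> C M -> C L.

(* Subcategories contain the zero modules; given the closure properties this
   only excludes the empty set of objects. *)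
Definition has_zero C : Prop :=
  forall M, (fullv : {vspace M}) = 0%VS -> C M.

Definition torsion_class C : Prop :=
  [/\ has_zero C, closed_extensions C & closed_factors C].

Definition torsion_free_class C : Prop :=
  [/\ has_zero C, closed_extensions C & closed_submodules C].

(* The smallest torsion class containing all the modules whose isoclass is
   in S. *)
Definition Tors S : modclass A :=
  fun M => forall C, torsion_class C ->
    (forall N, S (isoclass N) -> C N) -> C M.

Definition TorsFree S : modclass A :=
  fun M => forall C, torsion_free_class C ->
    (forall N, S (isoclass N) -> C N) -> C M.

(* Every module has a right C-approximation. *)
Definition contravariantly_finite C : Prop :=
  forall X, exists Y (f : 'Hom(Y, X)), [/\ C Y, Hom_mod f &
    forall Z (g : 'Hom(Z, X)), C Z -> Hom_mod g ->
      exists h : 'Hom(Z, Y), Hom_mod h /\ (g = f \o h)%VF].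

(* Every module has a left C-approximation. *)
Definition covariantly_finite C : Prop :=
  forall X, exists Y (f : 'Hom(X, Y)), [/\ C Y, Hom_mod f &
    forall Z (g : 'Hom(X, Z)), C Z -> Hom_mod g ->
      exists h : 'Hom(Y, Z), Hom_mod h /\ (g = h \o f)%VF].

Definition functorially_finite C : Prop :=
  contravariantly_finite C /\ covariantly_finite C.

Definition left_finite S : Prop := functorially_finite (Tors S).
Definition right_finite S : Prop := functorially_finite (TorsFree S).

End ModuleCategory.

(* Simple modules are cyclic, hence all of them lie in mod A. They form
   finitely many isoclasses, so that the default value 0 is never used. *)
Definition num_simples (K : fieldType) (A : falgType K) : nat :=
  xget 0%N [set n | has_card (isoclasses (@simple_module K A)) n].

(* Main.v *)
Require Import Defs.
From HB Require Import structures.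
From mathcomp Require Import all_boot all_algebra all_field.
From mathcomp Require Import boolp classical_sets.
From mathcomp Require Import zify.

(* The classes of the bricks S_i in a functorially finite torsion class T are
   linearly independent in the Grothendieck group. A nonzero map from an object
   of T to some S_i is surjective with kernel in T. Hence a module N_i in T of
   minimal length with a nonzero map to S_i that factors through every nonzero
   map Y -> S_i with Y in T is split projective in T and satisfies Hom(N_i, S_j) = 0 for
   j <> i; it exists because a minimal left T-approximation of a projective module is split
   projective in T. If 0 -> O -> P -> N_i -> 0 is exact with P projective, then
   for X in T every map from O to a quotient Q of X extends to P, as
   Ext^1(N_i, Q) = 0, and lifts to X. So Hom(O, -), and thus Hom(N_i, -), is
   additive along a composition series of X: on T, dim Hom(N_i, -) is an
   integral combination of the n composition multiplicities. The invertible diagonal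
   matrix (dim Hom(N_i, S_j)) therefore factors through Q^n.
   The torsion-free case is the same argument in the opposite category, which
   has enough projectives because mod A has enough injectives. *)

Set Implicit Arguments.
Unset Strict Implicit.
Unset Printing Implicit Defensive.
Import GRing.Theory.
Local Open Scope ring_scope.

(** * Minimal choices and dimensions in exact sequences *)

Lemma ex_min (T : Type) (P : T -> Prop) (h : T -> nat) :
  (exists x, P x) -> exists2 x, P x & forall y, P y -> (h x <= h y)%N.
Proof.
move=> [x Px]; have ex_n: exists n, `[< exists2 y, P y & h y = n >].
  by exists (h x); apply/asboolP; exists x.
case: (ex_minnP ex_n) => n /asboolP [y Py <-] hmin.
by exists y => // z Pz; apply: hmin; apply/asboolP; exists z.
Qed.

(** Rank-nullity applied to both maps. Bare functions with linearity proofs are used because the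
    maps in question are pre- and post-composition with a fixed morphism. *)
Lemma dim_exact (K : fieldType) (U V W : vectType K) (a : U -> V) (b : V -> W) :
  linear a -> linear b -> (forall u, a u = 0 -> u = 0) ->
  (forall u, b (a u) = 0) -> (forall v, b v = 0 -> exists u, a u = v) ->
  (forall w, exists v, b v = w) ->
  \dim {: V} = (\dim {: U} + \dim {: W})%N.
Proof.
move=> la lb inj_a ba0 exact_b surj_b.
pose aL : {linear U -> V} := HB.pack a (GRing.isLinear.Build _ _ _ _ _ la).
pose bL : {linear V -> W} := HB.pack b (GRing.isLinear.Build _ _ _ _ _ lb).
pose f : 'Hom(U, V) := linfun aL; pose g : 'Hom(V, W) := linfun bL.
have fE u : f u = a u by rewrite lfunE.
have gE v : g v = b v by rewrite lfunE.
have kf : lker f = 0%VS.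
  apply/eqP; rewrite -subv0; apply/subvP => u.
  by rewrite memv_ker fE memv0 => /eqP /inj_a ->.
have img : limg g = fullv.
  apply/eqP; rewrite eqEsubv subvf; apply/subvP => w _.
  by have [v <-] := surj_b w; rewrite -gE memv_img ?memvf.
have imf : limg f = lker g.
  apply/eqP; rewrite eqEsubv; apply/andP; split; apply/subvP => v.
    by move/memv_imgP => [u _ ->]; rewrite memv_ker gE fE ba0.
  rewrite memv_ker gE => /eqP /exact_b [u <-].
  by rewrite -fE memv_img ?memvf.
have := limg_ker_dim g fullv; rewrite capfv -imf img => <-.
by have := limg_ker_dim f fullv; rewrite capfv kf dimv0 add0n => ->.
Qed.

(** * Abelian categories of finite length *)

(* The axioms are self-dual, see [op]. Monomorphisms, epimorphisms and short exact
   sequences are primitive so that they unfold to kernel and image conditions in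
   mod A; the pullback and pushout axioms carry the induced exact sequence, and
   only the existence part of the universal property for one leg. *)
Record abcat (K : fieldType) := AbCat {
  ob : Type;
  hom : ob -> ob -> vectType K;
  comp : forall X Y Z, hom Y Z -> hom X Y -> hom X Z;
  idm : forall X, hom X X;
  mono : forall X Y, hom X Y -> Prop;
  epi : forall X Y, hom X Y -> Prop;
  ses : forall X Y Z, hom X Y -> hom Y Z -> Prop;
  len : ob -> nat;
  compA : forall W X Y Z (h : hom Y Z) (g : hom X Y) (f : hom W X),
    comp h (comp g f) = comp (comp h g) f;
  comp1l : forall X Y (f : hom X Y), comp (idm Y) f = f;
  comp1r : forall X Y (f : hom X Y), comp f (idm X) = f;
  comp_linl : forall X Y Z (f : hom X Y), linear (fun g : hom Y Z => comp g f);
  comp_linr : forall X Y Z (g : hom Y Z), linear (fun f : hom X Y => comp g f);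
  mono_cancel : forall X Y (f : hom X Y), mono f ->
    forall W (g : hom W X), comp f g = 0 -> g = 0;
  epi_cancel : forall X Y (f : hom X Y), epi f ->
    forall Z (g : hom Y Z), comp g f = 0 -> g = 0;
  mono1 : forall X, mono (idm X);
  epi1 : forall X, epi (idm X);
  mono_comp : forall X Y Z (g : hom Y Z) (f : hom X Y),
    mono g -> mono f -> mono (comp g f);
  epi_comp : forall X Y Z (g : hom Y Z) (f : hom X Y),
    epi g -> epi f -> epi (comp g f);
  mono_of_comp : forall X Y Z (g : hom Y Z) (f : hom X Y),
    mono (comp g f) -> mono f;
  epi_of_comp : forall X Y Z (g : hom Y Z) (f : hom X Y),
    epi (comp g f) -> epi g;
  image_factor : forall X Y (f : hom X Y),
    exists I (e : hom X I) (m : hom I Y), [/\ epi e, mono m & f = comp m e];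
  ses_mono : forall X Y Z (f : hom X Y) (g : hom Y Z), ses f g -> mono f;
  ses_epi : forall X Y Z (f : hom X Y) (g : hom Y Z), ses f g -> epi g;
  ses_comp0 : forall X Y Z (f : hom X Y) (g : hom Y Z), ses f g -> comp g f = 0;
  ses_ker : forall X Y Z (f : hom X Y) (g : hom Y Z), ses f g ->
    forall W (h : hom W Y), comp g h = 0 -> exists h', h = comp f h';
  ses_coker : forall X Y Z (f : hom X Y) (g : hom Y Z), ses f g ->
    forall W (h : hom Y W), comp h f = 0 -> exists h', h = comp h' g;
  mono_ses : forall X Y (f : hom X Y), mono f -> exists Z (g : hom Y Z), ses f g;
  epi_ses : forall Y Z (g : hom Y Z), epi g -> exists X (f : hom X Y), ses f g;
  len_ses : forall X Y Z (f : hom X Y) (g : hom Y Z), ses f g ->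
    len Y = (len X + len Z)%N;
  len0 : forall X, len X = 0%N <-> idm X = 0;
  pullback : forall L X Y Z (m : hom L X) (c : hom X Y) (g : hom Z Y), ses m c ->
    exists W (q : hom W X) (p : hom W Z) (m' : hom L W),
    [/\ ses m' p, comp c q = comp g p &
      forall V (h : hom V X) (h' : hom V Z), comp c h = comp g h' ->
        exists w, comp q w = h];
  pushout : forall L X Y Z (c : hom X L) (m : hom Y X) (g : hom Y Z), ses m c ->
    exists W (q : hom X W) (p : hom Z W) (c' : hom W L),
    [/\ ses p c', comp q m = comp p g &
      forall V (h : hom X V) (h' : hom Z V), comp h m = comp h' g ->
        exists w, comp w q = h]
}.

Arguments hom {K a} X Y.
Arguments comp {K a X Y Z}.
Arguments idm {K a} X.
Arguments mono {K a X Y}.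
Arguments epi {K a X Y}.
Arguments ses {K a X Y Z}.
Arguments len {K a} X.

Local Notation "g \oc f" := (comp g f) (at level 40, left associativity).

Lemma image_factor_op (K : fieldType) (C : abcat K) (X Y : ob C) (f : hom Y X) :
  exists I (e : hom I X) (m : hom Y I), [/\ mono e, epi m & f = e \oc m].
Proof. by have [I [e [m [ee mm fE]]]] := image_factor f; exists I, m, e. Qed.

Definition op (K : fieldType) (C : abcat K) : abcat K :=
  @AbCat K (ob C) (fun X Y => @hom _ C Y X) (fun X Y Z g f => comp f g)
    (fun X => idm X) (fun X Y f => epi f) (fun X Y f => mono f)
    (fun X Y Z f g => ses g f) (fun X => len X)
    (fun W X Y Z h g f => esym (compA f g h))
    (fun X Y f => comp1r f) (fun X Y f => comp1l f)
    (fun X Y Z f => comp_linr f) (fun X Y Z f => comp_linl f)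
    (fun X Y f => @epi_cancel _ _ _ _ f)
    (fun X Y f => @mono_cancel _ _ _ _ f)
    (@epi1 _ C) (@mono1 _ C)
    (fun X Y Z g f hg hf => epi_comp hf hg)
    (fun X Y Z g f hg hf => mono_comp hf hg)
    (fun X Y Z g f => @epi_of_comp _ _ _ _ _ f g)
    (fun X Y Z g f => @mono_of_comp _ _ _ _ _ f g)
    (fun X Y f => image_factor_op f)
    (fun X Y Z f g => @ses_epi _ _ _ _ _ g f)
    (fun X Y Z f g => @ses_mono _ _ _ _ _ g f)
    (fun X Y Z f g => @ses_comp0 _ _ _ _ _ g f)
    (fun X Y Z f g => @ses_coker _ _ _ _ _ g f)
    (fun X Y Z f g => @ses_ker _ _ _ _ _ g f)
    (fun X Y f => @epi_ses _ _ _ _ f)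
    (fun X Y f => @mono_ses _ _ _ _ f)
    (fun X Y Z f g s => etrans (len_ses s) (addnC _ _))
    (@len0 _ C)
    (fun L X Y Z m c g => @pushout _ C L X Y Z m c g)
    (fun L X Y Z m c g => @pullback _ C L X Y Z m c g).

(** * Additivity, splitting and length in an abelian category *)

Section AbelianTheory.
Variables (K : fieldType) (C : abcat K).
Implicit Types L M N P X Y Z : ob C.

Lemma comp0l X Y Z (f : hom X Y) : (0 : hom Y Z) \oc f = 0.
Proof.
by have /= := comp_linl f (- 1) (0 : hom Y Z) 0; rewrite scaler0 addr0 scaleN1r addNr.
Qed.

Lemma comp0r X Y Z (g : hom Y Z) : g \oc (0 : hom X Y) = 0.
Proof.
by have /= := comp_linr g (- 1) (0 : hom X Y) 0; rewrite scaler0 addr0 scaleN1r addNr.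
Qed.

Lemma compBl X Y Z (g h : hom Y Z) (f : hom X Y) : (g - h) \oc f = g \oc f - h \oc f.
Proof.
by have /= := comp_linl f (- 1) h g; rewrite !scaleN1r [- h + g]addrC [RHS]addrC.
Qed.

Lemma compBr X Y Z (g : hom Y Z) (f h : hom X Y) : g \oc (f - h) = g \oc f - g \oc h.
Proof.
by have /= := comp_linr g (- 1) h f; rewrite !scaleN1r [- h + f]addrC [RHS]addrC.
Qed.

Lemma mono_inj X Y (f : hom X Y) W (g h : hom W X) : mono f -> f \oc g = f \oc h -> g = h.
Proof.
move=> mf e; apply/eqP; rewrite -subr_eq0; apply/eqP/(mono_cancel mf).
by rewrite compBr e subrr.
Qed.

Lemma epi_inj X Y (f : hom X Y) Z (g h : hom Y Z) : epi f -> g \oc f = h \oc f -> g = h.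
Proof.
move=> ef e; apply/eqP; rewrite -subr_eq0; apply/eqP/(epi_cancel ef).
by rewrite compBl e subrr.
Qed.

Lemma split_epi X Y (f : hom X Y) (g : hom Y X) : f \oc g = idm Y -> epi f.
Proof.
by move=> fg; apply: (@epi_of_comp _ _ _ _ _ f g); rewrite fg; apply: epi1.
Qed.

(** The kernel has length 0, so it is a zero object and the identity of [X] factors through [f]. *)
Lemma epi_iso X Y (f : hom X Y) : epi f -> (len X <= len Y)%N ->
  exists g, g \oc f = idm X.
Proof.
move=> ef leXY; have [L [k s]] := epi_ses ef.
have /len0 L0 : len L = 0%N.
  by apply/eqP; have := leXY; rewrite (len_ses s) -{2}[len Y]add0n leq_add2r leqn0.
have [|g e] := ses_coker s (h := idm X); last by exists g.
by rewrite comp1l -(comp1r k) L0 comp0r.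
Qed.

(** This turns minimality of length into invertibility: if the image of an endomorphism is as long
    as [X], both factors of the endomorphism are invertible. *)
Lemma endo_iso X I (e : hom X I) (m : hom I X) : epi e -> (len X <= len I)%N ->
  mono m -> exists g, (m \oc e) \oc g = idm X.
Proof.
move=> ee le mm; have [g ge] := epi_iso ee le.
have [Z [c s]] := mono_ses mm.
have /len0 Z0 : len Z = 0%N.
  apply/eqP; rewrite -leqn0 -(leq_add2l (len I)) addn0 -(len_ses s).
  exact: le.
have eg : e \oc g = idm I.
  by apply: (epi_inj ee); rewrite -compA ge comp1r comp1l.
have [|h mh] := ses_ker s (h := idm X); first by rewrite -(comp1l c) Z0 !comp0l.
exists (g \oc h); rewrite -compA (compA e) eg comp1l; exact: esym.
Qed.

(** The endomorphism [idm Y - s \oc g] is killed by [g], hence factors through [f], and the factor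
    is the retraction. *)
Lemma split_ses X Y Z (f : hom X Y) (g : hom Y Z) (s : hom Z Y) :
  ses f g -> g \oc s = idm Z -> exists r, r \oc f = idm X.
Proof.
move=> sfg gs; have [|r e] := ses_ker sfg (h := idm Y - s \oc g).
  by rewrite compBr comp1r compA gs comp1l subrr.
exists r; apply: (mono_inj (ses_mono sfg)).
by rewrite compA -e compBl comp1l -compA (ses_comp0 sfg) comp0r subr0 comp1r.
Qed.

Definition dimhom X Y : nat := \dim {: hom X Y}.

(** In [op C] this says that [P] is injective in [C]. *)
Definition projective P : Prop :=
  forall Y Z (p : hom Y Z) (g : hom P Z), epi p -> exists h, p \oc h = g.

(** Hom(P, -) is left exact; the lifting hypothesis supplies surjectivity on the right and takes the
    place of a vanishing Ext group. *)
Lemma dimhom_sesr P X Y Z (f : hom X Y) (g : hom Y Z) : ses f g ->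
  (forall h : hom P Z, exists h', g \oc h' = h) ->
  dimhom P Y = (dimhom P X + dimhom P Z)%N.
Proof.
move=> s lift; apply: (dim_exact (comp_linr f) (comp_linr g)) => //.
- by move=> h /(mono_cancel (ses_mono s)).
- by move=> h; rewrite compA (ses_comp0 s) comp0l.
- by move=> h /(ses_ker s) [h' ->]; exists h'.
Qed.

Lemma dimhom_sesl Q X Y Z (f : hom X Y) (g : hom Y Z) : ses f g ->
  (forall h : hom X Q, exists h', h' \oc f = h) ->
  dimhom Y Q = (dimhom Z Q + dimhom X Q)%N.
Proof.
move=> s ext; apply: (dim_exact (comp_linl g) (comp_linl f)) => //.
- by move=> h /(epi_cancel (ses_epi s)).
- by move=> h; rewrite -compA (ses_comp0 s) comp0r.
- by move=> h /(ses_coker s) [h' ->]; exists h'.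
Qed.

(** The kernel of a nonzero map from [X] to the first object is strictly shorter than [X]. It still
    maps nontrivially to every other object, since a map vanishing on it would factor through the
    first object and be zero by orthogonality. *)
Lemma independent_len (k : nat) (s : 'I_k -> ob C) X :
  (forall i Y (f : hom Y (s i)), f <> 0 -> epi f) ->
  (forall i j (f : hom (s i) (s j)), i <> j -> f = 0) ->
  (forall i, idm (s i) <> 0) ->
  (forall i, exists f : hom X (s i), f <> 0) -> (k <= len X)%N.
Proof.
elim: k s X => // k IHk s X s_epi s_orth s_neq0 sX.
have [f f_neq0] := sX ord0; have [L [l sf]] := epi_ses (s_epi _ _ _ f_neq0).
rewrite (len_ses sf) -addn1 leq_add //; last first.
  by rewrite lt0n; apply/eqP => /len0 /s_neq0.
apply: (IHk (fun i => s (lift ord0 i))) => [i|i j g neq_ij|i|i].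
- exact: s_epi.
- by apply: s_orth => /lift_inj.
- exact: s_neq0.
have [g g_neq0] := sX (lift ord0 i).
exists (g \oc l) => gl0; have [h gE] := ses_coker sf gl0.
by apply: g_neq0; rewrite gE (s_orth _ _ h) ?comp0l //; apply/eqP/neq_lift.
Qed.

(** Read in [op C], these conditions describe a torsion-free class of [C]; likewise left
    approximations in [op C] are right approximations in [C]. *)
Definition torsion (T : ob C -> Prop) : Prop :=
  [/\ forall X, len X = 0%N -> T X,
      forall X Y Z (f : hom X Y) (g : hom Y Z), ses f g -> T X -> T Z -> T Y &
      forall X Y (g : hom X Y), epi g -> T X -> T Y].

Definition covariantly_finite_in (T : ob C -> Prop) : Prop :=
  forall X, exists Y (f : hom X Y), T Y /\
    forall Z (g : hom X Z), T Z -> exists h, g = h \oc f.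

End AbelianTheory.

(** * Bricks in a torsion class *)

Section Bound.
Variables (K : fieldType) (C : abcat K) (B T : ob C -> Prop).
Implicit Types L M N P X Y Z : ob C.
Hypothesis B_schur : forall M N (f : hom M N), B M -> B N -> f <> 0 ->
  exists g, g \oc f = idm M /\ f \oc g = idm N.
Hypothesis B_neq0 : forall M, B M -> idm M <> 0.
Hypothesis T_torsion : torsion T.
Hypothesis B_sub_T : forall M, B M -> T M.
Hypothesis T_min : forall D, torsion D -> (forall M, B M -> D M) ->
  forall X, T X -> D X.
Hypothesis T_covfin : covariantly_finite_in T.
Hypothesis enough_projectives : forall X,
  exists (P : ob C) (e : hom P X), epi e /\ projective P.
Variables (n : nat) (simp : 'I_n -> ob C).
Hypothesis simple_sub : forall X, len X <> 0%N ->
  exists i X' (f : hom (simp i) X) (g : hom X X'), ses f g.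
Hypothesis simp_neq0 : forall i, len (simp i) <> 0%N.

Let T_ext X Y Z (f : hom X Y) (g : hom Y Z) : ses f g -> T X -> T Z -> T Y.
Proof. by case: T_torsion => _ h _; apply: h. Qed.
Let T_quo X Y (g : hom X Y) : epi g -> T X -> T Y.
Proof. by case: T_torsion => _ _ h; apply: h. Qed.

(** The objects all of whose nonzero quotients receive a nonzero map from [B] form a torsion class
    containing [B], hence containing [T]. For an extension, either the image of the subobject in the
    quotient is nonzero, or the quotient is one of the right-hand term. *)
Lemma brick_to_torsion X : T X -> idm X <> 0 ->
  exists N (u : hom N X), B N /\ u <> 0.
Proof.
pose D X := forall Y (e : hom X Y), epi e -> idm Y <> 0 ->
  exists N (u : hom N Y), B N /\ u <> 0.
move=> TX X0; suff DX : D X by apply: (DX X (idm X)) => //; apply: epi1.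
apply: (T_min _ _ TX) => {X TX X0} [|M BM Y e ee Y0]; last first.
  exists M, e; split=> // e0; apply: Y0; apply: (epi_cancel ee).
  by rewrite e0 comp0r.
split=> [X /len0 X0 Y e ee Y0|X Y Z f g s DX DZ Q e ee Q0|X Y g eg DX Q e ee].
- case: Y0; apply: (epi_cancel ee); rewrite comp1l.
  by rewrite -(comp1r e) X0 comp0r.
- have [I [e' [m [ee' mm efE]]]] := image_factor (e \oc f).
  have [I0|/eqP I0] := eqVneq (idm I) 0; last first.
    have [N [u [BN u0]]] := DX _ _ ee' I0.
    exists N, (m \oc u); split=> // mu0; apply: u0; exact: (mono_cancel mm).
  have [|h eE] := ses_coker s (h := e).
    by rewrite efE -(comp1l e') I0 comp0l comp0r.
  by apply: (DZ Q h) => //; rewrite eE in ee; apply: epi_of_comp ee.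
- by apply: (DX Q (e \oc g)); apply: epi_comp.
Qed.

(** The image of [f] lies in [T], so some brick maps to it nontrivially. Composed with the inclusion
    into [M], this is a nonzero map between bricks, hence invertible, which makes the inclusion a
    split epimorphism. *)
Lemma torsion_to_brick_epi X M (f : hom X M) : T X -> B M -> f <> 0 -> epi f.
Proof.
move=> TX BM f0; have [I [e [m [ee mm fE]]]] := image_factor f.
have I0 : idm I <> 0 by move=> I0; apply: f0; rewrite fE -(comp1l e) I0 comp0l comp0r.
have [N [u [BN u0]]] := brick_to_torsion (T_quo ee TX) I0.
have [|g [_ mug]] := B_schur (f := m \oc u) BN BM.
  by move/(mono_cancel mm).
rewrite fE; apply: epi_comp => //; apply: (@split_epi _ _ _ _ _ (u \oc g)).
by rewrite compA.
Qed.

(** Induction on the length of [X], with a nonzero map [u] from a brick to [X]. If [f \oc u] is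
    nonzero, it is invertible, the sequence splits and [L] is a quotient of [X]. Otherwise [f]
    descends to the quotient of [X] by the image [I] of [u], where induction applies, and [L] is
    recovered from an extension by [I]. *)
Lemma torsion_kernel X M L (k : hom L X) (f : hom X M) :
  T X -> B M -> ses k f -> T L.
Proof.
have [d] := ubnP (len X); elim: d X L k f => // d IHd X L k f /ltnSE leXd TX BM s.
have ef := ses_epi s.
have X0 : idm X <> 0.
  move=> X0; apply: (B_neq0 BM); apply: (epi_cancel ef).
  by rewrite comp1l -(comp1r f) X0 comp0r.
have [N [u [BN u0]]] := brick_to_torsion TX X0.
have [fu0|/eqP fu0] := eqVneq (f \oc u) 0; last first.
  have [v [_ fuv]] := B_schur BN BM fu0.
  have [|r rk] := split_ses (s := u \oc v) s; first by rewrite compA.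
  exact: (T_quo (split_epi rk)).
have [I [e [m [ee mm uE]]]] := image_factor u.
have I0 : idm I <> 0 by move=> I0; apply: u0; rewrite uE -(comp1l e) I0 comp0l comp0r.
have TI : T I by apply: T_quo ee (B_sub_T BN).
have fm0 : f \oc m = 0 by apply: (epi_cancel ee); rewrite -compA -uE.
have [Y [c sc]] := mono_ses mm.
have [f' fE] := ses_coker sc fm0.
have ef' : epi f' by rewrite fE in ef; apply: epi_of_comp ef.
have [L' [k' s']] := epi_ses ef'.
have TL' : T L'.
  apply: (IHd Y L' k' f') => //; last exact: T_quo (ses_epi sc) TX.
  apply: leq_trans leXd; rewrite (len_ses sc) -add1n leq_add2r lt0n.
  by apply/eqP => /len0.
(* [W] is the preimage in [X] of the kernel [L'], an extension of [L'] by [I], hence in [T]. The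
   remaining lines exhibit [L] as a retract of [W]. *)
have [W [q [p [m' [sW cq univ]]]]] := pullback k' sc.
have TW : T W := T_ext sW TI TL'.
have [|h ckE] := ses_ker s' (h := c \oc k).
  by rewrite compA -fE (ses_comp0 s).
have [w qw] := univ _ _ _ ckE.
have [|z qE] := ses_ker s (h := q).
  by rewrite fE -compA cq compA (ses_comp0 s') comp0l.
apply: (@T_quo _ _ z _ TW); apply: (@split_epi _ _ _ _ _ w).
apply: (mono_inj (ses_mono s)); by rewrite compA -qE qw comp1r.
Qed.

(** * Split projective objects of a torsion class *)

Definition split_projective M :=
  forall Y (p : hom Y M), T Y -> epi p -> exists h, p \oc h = idm M.

(** [N] is the target of a left [T]-approximation of minimal length, taken from a projective [P]
    covering [M]. Given an epimorphism [p] onto [N] from [T], the approximation [f] lifts through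
    [p] by projectivity, and the lift factors through [f] again, so [p \oc g] fixes [f]. *)
Lemma split_projective_cover M : B M ->
  exists N (f : hom N M), [/\ T N, f <> 0 & split_projective N].
Proof.
move=> BM; have [P [e [ee projP]]] := enough_projectives M.
pose Q (Yf : {Y : ob C & hom P Y}) := T (tag Yf) /\
    forall Z (g : hom P Z), T Z -> exists h, g = h \oc tagged Yf.
have [|[N f] [/= TN fN] Nmin] := @ex_min _ Q (fun Yf => len (tag Yf)).
  have [Y [f [TY fY]]] := T_covfin P.
  by exists (Tagged (fun Y => hom P Y) f).
have [h eE] := fN _ e (B_sub_T BM).
exists N, h; split=> //.
  move=> h0; apply: (B_neq0 BM); apply: (epi_cancel ee).
  by rewrite eE h0 comp0l comp0r.
move=> Y p TY ep.
have [f' pf'] := projP _ _ p f ep.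
have [g f'E] := fN _ f' TY.
(* The corestriction of [f] to the image [I] is again a left [T]-approximation of [P], so minimality
   forbids [I] to be shorter than [N]. *)
have [I [e' [m [ee' mm pgE]]]] := image_factor (p \oc g).
have TI := T_quo ee' TN.
have fE : f = (m \oc e') \oc f by rewrite -pgE -compA -f'E pf'.
have [|t tE] := endo_iso ee' _ mm.
  have := Nmin (Tagged (fun Y => hom P Y) (e' \oc f)) => /=; apply; split=> //= Z a TZ.
  have [b ->] := fN _ a TZ; exists (b \oc m).
  by rewrite -compA (compA m) -fE.
by exists (g \oc t); rewrite compA pgE.
Qed.

(** Among the nonzero maps from [T] to [M] that lift through every nonzero map from [T] to [M], one
    with source of minimal length is taken. Minimality makes every endomorphism fixing this map
    right invertible, from which both the splitting and the orthogonality follow. *)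
Lemma dual_projective M : B M ->
  exists N, [/\ T N, split_projective N, dimhom N M <> 0%N &
    forall M', B M' -> (forall f : hom M' M, f = 0) -> dimhom N M' = 0%N].
Proof.
move=> BM.
pose Q (Nf : {N : ob C & hom N M}) := [/\ T (tag Nf), tagged Nf <> 0 &
  forall Y (q : hom Y M), T Y -> q <> 0 -> exists h, q \oc h = tagged Nf].
have [|[N f] [/= TN f0 f_lift] Nmin] := @ex_min _ Q (fun Nf => len (tag Nf)).
  have [N [f [TN f0 projN]]] := split_projective_cover BM.
  exists (Tagged (fun N => hom N M) f); split=> //= Y q TY q0.
  (* The pullback [W] of [q] along [f] is an extension of [N] by the kernel of [q], hence lies in
     [T]. So [W] maps onto [N] with a section, which gives the lift of [f] through [q]. *)
  have [L [l s]] := epi_ses (torsion_to_brick_epi TY BM q0).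
  have [W [a [p [m' [sW qa _]]]]] := pullback f s.
  have TW : T W := T_ext sW (torsion_kernel TY BM s) TN.
  have [h ph] := projN _ p TW (ses_epi sW).
  by exists (a \oc h); rewrite compA qa -compA ph comp1r.
(* The restriction of [f] to the image of [e] has the same lifting property, so the image is not
   shorter than [N]. *)
have N_iso (e : hom N N) : f \oc e = f -> exists g, e \oc g = idm N.
  have [I [e' [m [ee' mm ->]]]] := image_factor e => fe.
  apply: (endo_iso ee' _ mm).
  have := Nmin (Tagged (fun N => hom N M) (f \oc m)) => /=; apply; split=> /=.
  - exact: T_quo ee' TN.
  - by move=> fm0; apply: f0; rewrite -fe compA fm0 comp0l.
  - move=> Y q TY q0; have [h qh] := f_lift _ q TY q0.
    by exists (h \oc m); rewrite compA qh.
have f_epi := torsion_to_brick_epi TN BM f0.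
exists N; split=> //.
- move=> Y p TY ep; have [|h fph] := f_lift _ (f \oc p) TY.
    by move/(epi_cancel ep).
  by have [|g e] := N_iso (p \oc h); rewrite ?compA //; exists (h \oc g); rewrite compA.
- move=> /eqP; rewrite dimv_eq0 => /eqP d0; apply: f0.
  by apply/eqP; rewrite -memv0 -d0 memvf.
move=> M' BM' M'M; apply/eqP; rewrite dimv_eq0 -subv0; apply/subvP => s _.
rewrite memv0; apply/eqP; apply: contrapT => s0.
(* If [f] vanished on the kernel [L] of [s], it would factor through a map from [M'] to [M], which
   is zero. So [f] lifts through [L], the inclusion [l] gets a right inverse, and [s] is zero. *)
have [L [l sl]] := epi_ses (torsion_to_brick_epi TN BM' s0).
have [|h flh] := f_lift L (f \oc l) (torsion_kernel TN BM' sl).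
  move=> fl0; have [a fE] := ses_coker sl fl0.
  by apply: f0; rewrite fE (M'M a) comp0l.
have [|g e] := N_iso (l \oc h); first by rewrite compA.
by apply: s0; rewrite -(comp1r s) -e -compA compA (ses_comp0 sl) comp0l.
Qed.

(* [c] counts composition factors; it must not depend on [N]. *)
Lemma dimhom_split_projective X : T X -> exists c : 'I_n -> nat,
  forall N, T N -> split_projective N -> forall P O (i : hom O P) (e : hom P N),
    ses i e -> projective P ->
    (dimhom N X)%:Z = \sum_j ((dimhom P (simp j))%:Z - (dimhom O (simp j))%:Z) *+ c j.
Proof.
(* This is the vanishing of Ext^1(N, Y): the pushout along [h] is an extension of [N] by [Y], hence
   lies in [T] and splits. *)
have N_ext N P O (i : hom O P) (e : hom P N) : T N -> split_projective N -> ses i e ->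
    forall Y, T Y -> forall h : hom O Y, exists h', h' \oc i = h.
  move=> TN projN s Y TY h.
  have [W [q [p [c' [sW qi _]]]]] := pushout h s.
  have [t ct] := projN _ c' (T_ext sW TY TN) (ses_epi sW).
  have [r rp] := split_ses sW ct.
  by exists (r \oc q); rewrite -compA qi compA rp comp1l.
have [d] := ubnP (len X); elim: d X => // d IHd X /ltnSE leXd TX.
have [X0|/eqP X0] := eqVneq (len X) 0%N.
  exists (fun=> 0%N) => N TN projN P O i e s projP.
  rewrite big1 // /dimhom; congr Posz.
  apply/eqP; rewrite dimv_eq0 -subv0; apply/subvP => h _.
  by rewrite memv0 -(comp1l h); move/len0: X0 => ->; rewrite comp0l.
have [i [X' [f [g s]]]] := simple_sub X0.
have TX' := T_quo (ses_epi s) TX.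
have [|c cE] := IHd X' _ TX'.
  apply: leq_trans leXd; rewrite (len_ses s) -add1n leq_add2r lt0n.
  by apply/eqP/simp_neq0.
(* The simple subobject [simp i] of [X] adds one to its own multiplicity. *)
exists (fun j => c j + (j == i))%N => N TN projN P O a e sN projP.
have ext := N_ext _ _ _ _ _ TN projN sN.
under eq_bigr => j _ do rewrite mulrnDr.
rewrite big_split /= -(cE _ TN projN _ _ _ _ sN projP) (bigD1 i) //= eqxx mulr1n.
rewrite big1 ?addr0 => [|j /negPf ->]; last by rewrite mulr0n.
have := dimhom_sesl sN (ext X TX); have := dimhom_sesl sN (ext X' TX').
have := dimhom_sesr s (fun h => projP _ _ g h (ses_epi s)).
(* The subobject [simp i] may lie outside [T], so additivity comes from lifting instead: a map from
   [O] to [X'] extends to [P], and then lifts to [X] because [P] is projective. *)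
have -> : dimhom O X = (dimhom O (simp i) + dimhom O X')%N.
  apply: (dimhom_sesr s) => h.
  have [h' <-] := ext _ TX' h.
  have [h'' <-] := projP _ _ g h' (ses_epi s).
  by exists (h'' \oc a); rewrite compA.
move=> -> -> e1; apply/eqP; rewrite addrA eq_sym subr_eq eq_sym.
by rewrite -!PoszD eqz_nat; apply/eqP; lia.
Qed.

Lemma semibrick_bound (k : nat) (F : 'I_k -> ob C) : (forall i, B (F i)) ->
  (forall i j (f : hom (F i) (F j)), i <> j -> f = 0) -> (k <= n)%N.
Proof.
move=> BF F_orth.
have /fin_all_exists [c cP] := fun j => dimhom_split_projective (B_sub_T (BF j)).
(* The boolean equation says at once that the diagonal sums are nonzero and that the others
   vanish. *)
have phi_ex i : exists phi : 'I_n -> int, forall j,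
    (\sum_l phi l *+ c j l != 0) = (i == j).
  have [N [TN projN dNi dNj]] := dual_projective (BF i).
  have [P [e [ee projP]]] := enough_projectives N.
  have [O [a s]] := epi_ses ee.
  exists (fun l => (dimhom P (simp l))%:Z - (dimhom O (simp l))%:Z) => j.
  rewrite -(cP j N TN projN _ _ _ _ s projP) eqz_nat.
  have [<-|/eqP neq_ij] := eqVneq i j; first exact/eqP.
  by rewrite dNj // => f; apply: F_orth => eq_ji; apply: neq_ij.
have {phi_ex} /fin_all_exists [phi phiP] := phi_ex.
pose Phi := \matrix_(i < k, l < n) (phi i l)%:~R : 'M[rat]_(k, n).
pose Cm := \matrix_(l < n, j < k) (c j l)%:R : 'M[rat]_(n, k).
have DE i j : (Phi *m Cm) i j = (\sum_l phi i l *+ c j l)%:~R.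
  rewrite mxE rmorph_sum; apply: eq_bigr => l _.
  by rewrite !mxE mulr_natr raddfMn.
have D_unit : Phi *m Cm \in unitmx.
  have -> : Phi *m Cm = diag_mx (\row_i (Phi *m Cm) i i).
    apply/matrixP => i j; rewrite [RHS]mxE DE mxE DE.
    have [->//|neq_ij] := eqVneq i j.
    by have := phiP i j; rewrite (negPf neq_ij) mulr0n => /negbFE/eqP ->.
  rewrite unitmxE det_diag unitfE; apply/prodf_neq0 => i _.
  by rewrite mxE DE intr_eq0 phiP.
rewrite -(mxrank_unit D_unit); apply: leq_trans (mxrankM_maxl _ _) _.
exact: rank_leq_col.
Qed.
End Bound.

(** * The category of modules *)

(** A subspace of maximal dimension among those inside [P] is all of [P], because adding the line of
    a vector of [P] stays inside [P]. *)
Lemma vspace_of_pred (K : fieldType) (V : vectType K) (P : V -> Prop) :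
  P 0 -> (forall k u v, P u -> P v -> P (k *: u + v)) ->
  exists U : {vspace V}, forall v, v \in U <-> P v.
Proof.
move=> P0 Plin; pose Q (U : {vspace V}) := forall v, v \in U -> P v.
have [|U QU Umax] := @ex_min _ Q (fun U => \dim {: V} - \dim U)%N.
  by exists 0%VS => v; rewrite memv0 => /eqP ->.
exists U => v; split=> [|Pv]; first exact: QU.
have QU' : Q (U + <[v]>)%VS.
  move=> _ /memv_addP [u Uu [_ /vlineP [k ->] ->]].
  by rewrite addrC; apply: Plin => //; apply: QU.
have := Umax _ QU'; have := dimvS (subvf (U + <[v]>)%VS).
have sU : (U <= U + <[v]>)%VS by apply: addvSl.
have := dimvS sU => d1 d2 d3.
have /eqP -> : U == (U + <[v]>)%VS.
  rewrite eqEdim sU /=; lia.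
by apply: (subvP (addvSr _ _)); apply: memv_line.
Qed.

Section Modules.
Context {K : fieldType} {A : falgType K}.
Implicit Types L M N X Y Z W : rmod A.

Lemma ract0l M a : ract (0 : M) a = 0.
Proof. by have := ractZl 0 (0 : M) a; rewrite !scale0r. Qed.

Lemma ractNl M (x : M) a : ract (- x) a = - ract x a.
Proof. by rewrite -scaleN1r ractZl scaleN1r. Qed.

Lemma ractBl M (x y : M) a : ract (x - y) a = ract x a - ract y a.
Proof. by rewrite ractDl ractNl. Qed.

Lemma homspace_ex M N : exists U : {vspace 'Hom(M, N)},
  forall f, f \in U <-> Hom_mod f.
Proof.
apply: vspace_of_pred => [x a|k f g hf hg x a]; first by rewrite !zero_lfunE ract0l.
by rewrite !(add_lfunE, scale_lfunE) hf hg ractDl ractZl.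
Qed.

Definition homspace M N : {vspace 'Hom(M, N)} := projT1 (cid (homspace_ex M N)).

Lemma homspaceP M N (f : 'Hom(M, N)) : f \in homspace M N <-> Hom_mod f.
Proof. exact: (projT2 (cid (homspace_ex M N))). Qed.

(** Module homomorphisms form a [vectType] of their own, so that Hom_A(M, N) has a dimension. *)
Definition mhom M N : vectType K := subvs_of (homspace M N).
Definition lf M N (f : mhom M N) : 'Hom(M, N) := vsval f.

Lemma lfP M N (f : mhom M N) : Hom_mod (lf f).
Proof. exact/homspaceP/subvsP. Qed.

Lemma lf_ract M N (f : mhom M N) x a : lf f (ract x a) = ract (lf f x) a.
Proof. exact: lfP. Qed.

Lemma lf_inj M N (f g : mhom M N) : (forall x, lf f x = lf g x) -> f = g.
Proof. by move=> fg; apply: subvs_inj; apply/lfunP. Qed.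

Lemma lf_lin M N k (f g : mhom M N) x : lf (k *: f + g) x = k *: lf f x + lf g x.
Proof. by rewrite /lf linearP add_lfunE scale_lfunE. Qed.

Lemma lf0 M N x : lf (0 : mhom M N) x = 0.
Proof. by rewrite /lf linear0 zero_lfunE. Qed.

Definition mkhom M N (f : 'Hom(M, N)) : mhom M N := vsproj (homspace M N) f.

Lemma mkhomK M N (f : 'Hom(M, N)) : Hom_mod f -> lf (mkhom f) = f.
Proof. by move=> /homspaceP; apply: vsprojK. Qed.

Definition mcomp X Y Z (g : mhom Y Z) (f : mhom X Y) : mhom X Z :=
  mkhom (lf g \o lf f)%VF.

Lemma mcompE X Y Z (g : mhom Y Z) (f : mhom X Y) x : lf (mcomp g f) x = lf g (lf f x).
Proof.
by rewrite mkhomK ?comp_lfunE // => {}x a; rewrite !comp_lfunE !lf_ract.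
Qed.

Definition mid M : mhom M M := mkhom \1%VF.

Lemma midE M x : lf (mid M) x = x.
Proof. by rewrite mkhomK ?id_lfunE // => {}x a; rewrite !id_lfunE. Qed.

Definition mmono X Y (f : mhom X Y) := lker (lf f) = 0%VS.
Definition mepi X Y (f : mhom X Y) := limg (lf f) = fullv.
Definition mses X Y Z (f : mhom X Y) (g : mhom Y Z) :=
  [/\ lker (lf f) = 0%VS, limg (lf f) = lker (lf g) & limg (lf g) = fullv].
(** The dimension over [K] serves as length: it is additive on exact sequences and vanishes exactly
    on zero modules. *)
Definition mlen M := \dim {: M}.

Lemma mmonoP X Y (f : mhom X Y) : mmono f <-> forall x, lf f x = 0 -> x = 0.
Proof.
split=> [kf x fx|inj_f]; first by apply/eqP; rewrite -memv0 -kf memv_ker fx.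
by apply/eqP; rewrite -subv0; apply/subvP => x; rewrite memv_ker memv0 => /eqP/inj_f ->.
Qed.

Lemma mepiP X Y (f : mhom X Y) : mepi f <-> forall y, exists x, lf f x = y.
Proof.
split=> [imf y|surj_f].
  have /memv_imgP [x _ ->] : y \in limg (lf f) by rewrite imf memvf.
  by exists x.
apply/eqP; rewrite eqEsubv subvf; apply/subvP => y _.
by have [x <-] := surj_f y; rewrite memv_img ?memvf.
Qed.

Lemma msesP X Y Z (f : mhom X Y) (g : mhom Y Z) :
  mses f g <-> [/\ mmono f, forall y, lf g y = 0 <-> exists x, lf f x = y & mepi g].
Proof.
split=> [[kf fg img]|[kf fg img]]; split=> //.
  move=> y; split=> [gy0|[x <-]].
    have /memv_imgP [x _ ->] : y \in limg (lf f) by rewrite fg memv_ker gy0.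
    by exists x.
  by apply/eqP; rewrite -memv_ker -fg memv_img ?memvf.
apply/eqP; rewrite eqEsubv; apply/andP; split; apply/subvP => y.
  by move=> /memv_imgP [x _ ->]; rewrite memv_ker; apply/eqP/fg; exists x.
by rewrite memv_ker => /eqP/fg [x <-]; rewrite memv_img ?memvf.
Qed.

Lemma mhom_ex M N (f : M -> N) : linear f ->
  (forall x a, f (ract x a) = ract (f x) a) ->
  exists F : mhom M N, forall x, lf F x = f x.
Proof.
move=> lin_f f_ract.
pose fL : {linear M -> N} := HB.pack f (GRing.isLinear.Build _ _ _ _ _ lin_f).
exists (mkhom (linfun fL)) => x; rewrite mkhomK ?lfunE // => {}x a.
by rewrite !lfunE /= f_ract.
Qed.

(** The lift is [h] followed by a linear left inverse of [i]; it commutes with the action because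
    [i] is injective. *)
Lemma mono_lift L M W (i : mhom L M) (h : mhom W M) : mmono i ->
  (forall w, exists y, lf i y = lf h w) -> exists h', h = mcomp i h'.
Proof.
move=> /mmonoP mi hi; pose f := ((lf i)^-1 \o lf h)%VF.
have fK w : lf i (f w) = lf h w.
  have [y yE] := hi w; rewrite comp_lfunE limg_lfunVK // -yE.
  exact: memv_img (memvf _).
have hf : Hom_mod f.
  move=> w a; apply/eqP; rewrite -subr_eq0; apply/eqP/mi.
  by rewrite raddfB /= lf_ract !fK lf_ract subrr.
by exists (mkhom f); apply: lf_inj => w; rewrite mcompE mkhomK.
Qed.

(** The factor is [h] after a linear section of [p]; it commutes with the action because [h] depends
    only on the value of [p]. *)
Lemma epi_factor M N W (p : mhom M N) (h : mhom M W) : mepi p ->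
  (forall x, lf p x = 0 -> lf h x = 0) -> exists h', h = mcomp h' p.
Proof.
move=> ep ph; pose f := (lf h \o (lf p)^-1)%VF.
have pK y : lf p ((lf p)^-1%VF y) = y.
  by rewrite limg_lfunVK // ep memvf.
have h_eq x y : lf p x = lf p y -> lf h x = lf h y.
  move=> pxy; apply/eqP; rewrite -subr_eq0 -raddfB; apply/eqP/ph.
  by rewrite raddfB /= pxy subrr.
have hf : Hom_mod f.
  move=> y a; rewrite !comp_lfunE -lf_ract; apply: h_eq.
  by rewrite lf_ract !pK.
exists (mkhom f); apply: lf_inj => x; rewrite mcompE mkhomK // comp_lfunE.
by apply: h_eq; rewrite pK.
Qed.

(** * Submodules and quotient modules *)

Section Submodule.
Variables (M : rmod A) (U : {vspace M}) (subU : submodule U).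
Definition sub_act (x : subvs_of U) a : subvs_of U := vsproj U (ract (vsval x) a).

Let sub_actE x a : vsval (sub_act x a) = ract (vsval x) a.
Proof. by rewrite vsprojK // subU ?subvsP. Qed.

Definition submod : rmod A.
Proof.
apply: (@RMod _ _ (subvs_of U) sub_act) => *; apply: subvs_inj;
  rewrite ?(linearD, linearZ) /= !sub_actE ?(linearD, linearZ) /=.
- by rewrite ractDl.
- by rewrite ractDr.
- by rewrite ractZl.
- by rewrite ractZr.
- by rewrite ractM.
- by rewrite ract1.
Defined.

Lemma submod_ex : exists i : mhom submod M, mmono i /\
  forall x, x \in U <-> exists y, lf i y = x.
Proof.
have [//|x a|i iE] := @mhom_ex submod M vsval; first exact: sub_actE.
exists i; split.
  by apply/mmonoP => x; rewrite iE => x0; apply: subvs_inj; rewrite x0 linear0.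
move=> x; split=> [Ux|[y <-]]; last by rewrite iE subvsP.
by exists (vsproj U x); rewrite iE vsprojK.
Qed.
End Submodule.

Lemma sub_ex M (P : M -> Prop) : P 0 -> (forall k u v, P u -> P v -> P (k *: u + v)) ->
  (forall u a, P u -> P (ract u a)) ->
  exists L (i : mhom L M), mmono i /\ forall x, P x <-> exists y, lf i y = x.
Proof.
move=> P0 Plin Pact; have [U UP] := vspace_of_pred P0 Plin.
have subU : submodule U by move=> x a /UP Px; apply/UP/Pact.
have [i [mi iE]] := submod_ex subU.
by exists (submod subU), i; split=> // x; rewrite -UP.
Qed.

Section Quotient.
Variables (M : rmod A) (U : {vspace M}) (subU : submodule U).
(** The quotient of [M] by [U] is carried by the complement [U^C], and [quo_proj] is the projection
    along [U]. *)
Definition quo_proj (x : M) : subvs_of (U^C)%VS := vsproj (U^C)%VS (x - projv U x).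
Definition quo_act (y : subvs_of (U^C)%VS) a := quo_proj (ract (vsval y) a).

Lemma quo_projE x : vsval (quo_proj x) = x - projv U x.
Proof. by rewrite vsprojK // memv_projC. Qed.

Lemma quo_proj_lin : linear quo_proj.
Proof.
move=> k x y; apply: subvs_inj.
rewrite linearP /= !quo_projE linearP /= scalerBr opprD !addrA; congr (_ + _).
by rewrite -!addrA; congr (_ + _); rewrite addrC.
Qed.

Lemma quo_proj_eq0 x : quo_proj x = 0 <-> x \in U.
Proof.
split=> [e|Ux].
  have := quo_projE x; rewrite e linear0 => /esym/eqP.
  by rewrite subr_eq0 => /eqP ->; apply: memv_proj.
by apply: subvs_inj; rewrite quo_projE projv_id // subrr linear0.
Qed.

Lemma quo_proj_eq x y : x - y \in U -> quo_proj x = quo_proj y.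
Proof.
move/quo_proj_eq0; have := quo_proj_lin (-1) y x.
by rewrite !scaleN1r [- y + x]addrC => -> /eqP; rewrite addrC subr_eq0 => /eqP.
Qed.

Lemma quo_projK y : quo_proj (vsval y) = y.
Proof.
apply: subvs_inj; rewrite quo_projE; apply/eqP; rewrite subr_eq addrC -subr_eq.
rewrite subrr eq_sym -memv0 -(capv_compl U) memv_cap memv_proj /=.
have -> : projv U (vsval y) = vsval y - (vsval y - projv U (vsval y)).
  by rewrite opprB addrC subrK.
by rewrite rpredB ?subvsP ?memv_projC.
Qed.

Lemma quo_proj_act x a : quo_proj (ract x a) = quo_act (quo_proj x) a.
Proof.
apply: quo_proj_eq; rewrite -ractBl; apply: subU.
by rewrite quo_projE opprB addrC subrK memv_proj.
Qed.

Lemma quo_projD : {morph quo_proj : x y / x + y}.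
Proof. by move=> x y; have := quo_proj_lin 1 x y; rewrite !scale1r. Qed.

Lemma quo_projZ k : {morph quo_proj : x / k *: x}.
Proof.
move=> x; have := quo_proj_lin k x 0; rewrite !addr0 => ->.
by have /quo_proj_eq0 -> := mem0v U; rewrite addr0.
Qed.

Definition quomod : rmod A.
Proof.
apply: (@RMod _ _ (subvs_of U^C) quo_act) => [x y a|x a b|k x a|k x a|x a b|x].
- by rewrite /quo_act -quo_projD linearD /= ractDl.
- by rewrite /quo_act -quo_projD ractDr.
- by rewrite /quo_act -quo_projZ linearZ /= ractZl.
- by rewrite /quo_act -quo_projZ ractZr.
- by rewrite /quo_act ractM quo_proj_act.
- by rewrite /quo_act ract1 quo_projK.
Defined.

Lemma quomod_ex : exists p : mhom M quomod, mepi p /\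
  forall x, lf p x = 0 <-> x \in U.
Proof.
have [||p pE] := @mhom_ex M quomod quo_proj.
- exact: quo_proj_lin.
- exact: quo_proj_act.
exists p; split; last by move=> x; rewrite pE; apply: quo_proj_eq0.
by apply/mepiP => y; exists (vsval y); rewrite pE quo_projK.
Qed.
End Quotient.

Lemma quo_ex M (P : M -> Prop) : P 0 -> (forall k u v, P u -> P v -> P (k *: u + v)) ->
  (forall u a, P u -> P (ract u a)) ->
  exists N (p : mhom M N), mepi p /\ forall x, lf p x = 0 <-> P x.
Proof.
move=> P0 Plin Pact; have [U UP] := vspace_of_pred P0 Plin.
have subU : submodule U by move=> x a /UP Px; apply/UP/Pact.
have [p [ep pE]] := quomod_ex subU.
by exists (quomod subU), p; split=> // x; rewrite -UP.
Qed.

(** * Products of modules *)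

Definition prodmod X Z : rmod A.
Proof.
apply: (@RMod _ _ (X * Z)%type (fun u a => (ract u.1 a, ract u.2 a))) => *;
  apply: injective_projections => /=.
all: by rewrite ?(ractDl, ractDr, ractZl, ractZr, ractM, ract1).
Defined.

Lemma pr1_ex X Z : exists p : mhom (prodmod X Z) X, forall u, lf p u = u.1.
Proof. exact: (@mhom_ex (prodmod X Z) X fst). Qed.

Lemma pr2_ex X Z : exists p : mhom (prodmod X Z) Z, forall u, lf p u = u.2.
Proof. exact: (@mhom_ex (prodmod X Z) Z snd). Qed.

Lemma pair_ex X Z W (f : mhom W X) (g : mhom W Z) :
  exists h : mhom W (prodmod X Z), forall w, lf h w = (lf f w, lf g w).
Proof.
apply: (@mhom_ex W (prodmod X Z) (fun w => (lf f w, lf g w))).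
  by move=> k u v; rewrite !linearP.
by move=> x a; rewrite !lf_ract.
Qed.

Lemma copair_ex X Z W (f : mhom X W) (g : mhom Z W) :
  exists h : mhom (prodmod X Z) W, forall u, lf h u = lf f u.1 + lf g u.2.
Proof.
apply: (@mhom_ex (prodmod X Z) W (fun u => lf f u.1 + lf g u.2)).
  by move=> k u v; rewrite !linearP /= scalerDr addrACA.
by move=> x a; rewrite !lf_ract ractDl.
Qed.

(** * The axioms of [abcat] for modules *)

Lemma mcompA W X Y Z (h : mhom Y Z) (g : mhom X Y) (f : mhom W X) :
  mcomp h (mcomp g f) = mcomp (mcomp h g) f.
Proof. by apply: lf_inj => x; rewrite !mcompE. Qed.

Lemma mcomp1l X Y (f : mhom X Y) : mcomp (mid Y) f = f.
Proof. by apply: lf_inj => x; rewrite mcompE midE. Qed.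

Lemma mcomp1r X Y (f : mhom X Y) : mcomp f (mid X) = f.
Proof. by apply: lf_inj => x; rewrite mcompE midE. Qed.

Lemma mcomp_linl X Y Z (f : mhom X Y) : linear (fun g : mhom Y Z => mcomp g f).
Proof. by move=> k g h; apply: lf_inj => x; rewrite lf_lin !mcompE lf_lin. Qed.

Lemma mcomp_linr X Y Z (g : mhom Y Z) : linear (fun f : mhom X Y => mcomp g f).
Proof.
by move=> k f h; apply: lf_inj => x; rewrite lf_lin !mcompE lf_lin linearP.
Qed.

Lemma mmono_cancel X Y (f : mhom X Y) : mmono f ->
  forall W (g : mhom W X), mcomp f g = 0 -> g = 0.
Proof.
move=> /mmonoP mf W g fg; apply: lf_inj => x; rewrite lf0; apply: mf.
by rewrite -mcompE fg lf0.
Qed.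

Lemma mepi_cancel X Y (f : mhom X Y) : mepi f ->
  forall Z (g : mhom Y Z), mcomp g f = 0 -> g = 0.
Proof.
move=> /mepiP ef Z g gf; apply: lf_inj => y; rewrite lf0.
by have [x <-] := ef y; rewrite -mcompE gf lf0.
Qed.

Lemma mmono1 X : mmono (mid X).
Proof. by apply/mmonoP => x; rewrite midE. Qed.

Lemma mepi1 X : mepi (mid X).
Proof. by apply/mepiP => x; exists x; rewrite midE. Qed.

Lemma mmono_comp X Y Z (g : mhom Y Z) (f : mhom X Y) :
  mmono g -> mmono f -> mmono (mcomp g f).
Proof.
by move=> /mmonoP mg /mmonoP mf; apply/mmonoP => x; rewrite mcompE => /mg/mf.
Qed.

Lemma mepi_comp X Y Z (g : mhom Y Z) (f : mhom X Y) :
  mepi g -> mepi f -> mepi (mcomp g f).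
Proof.
move=> /mepiP eg /mepiP ef; apply/mepiP => z; have [y <-] := eg z.
by have [x <-] := ef y; exists x; rewrite mcompE.
Qed.

Lemma mmono_of_comp X Y Z (g : mhom Y Z) (f : mhom X Y) :
  mmono (mcomp g f) -> mmono f.
Proof.
by move=> /mmonoP mgf; apply/mmonoP => x fx; apply: mgf; rewrite mcompE fx linear0.
Qed.

Lemma mepi_of_comp X Y Z (g : mhom Y Z) (f : mhom X Y) :
  mepi (mcomp g f) -> mepi g.
Proof.
move=> /mepiP egf; apply/mepiP => z; have [x <-] := egf z.
by exists (lf f x); rewrite mcompE.
Qed.

Lemma mimage_factor X Y (f : mhom X Y) :
  exists I (e : mhom X I) (m : mhom I Y), [/\ mepi e, mmono m & f = mcomp m e].
Proof.
have [|k u v [x <-] [y <-]|u a [x <-]|I [m [mm mE]]] :=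
    @sub_ex Y (fun y => exists x, lf f x = y).
- by exists 0; rewrite linear0.
- by exists (k *: x + y); rewrite linearP.
- by exists (ract x a); rewrite lf_ract.
have [|e fE] := mono_lift (h := f) mm; first by move=> x; apply/mE; exists x.
exists I, e, m; split=> //; apply/mepiP => y.
have [x mxy] : exists x, lf f x = lf m y by apply/mE; exists y.
exists x; apply/eqP; rewrite -subr_eq0; apply/eqP; move/mmonoP: mm; apply.
by rewrite raddfB /= -mxy fE mcompE subrr.
Qed.

Lemma mses_mono X Y Z (f : mhom X Y) (g : mhom Y Z) : mses f g -> mmono f.
Proof. by case. Qed.

Lemma mses_epi X Y Z (f : mhom X Y) (g : mhom Y Z) : mses f g -> mepi g.
Proof. by case. Qed.

Lemma mses_comp0 X Y Z (f : mhom X Y) (g : mhom Y Z) : mses f g -> mcomp g f = 0.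
Proof.
move=> /msesP [_ fg _]; apply: lf_inj => x.
by rewrite mcompE lf0; apply/fg; exists x.
Qed.

Lemma mses_ker X Y Z (f : mhom X Y) (g : mhom Y Z) : mses f g ->
  forall W (h : mhom W Y), mcomp g h = 0 -> exists h', h = mcomp f h'.
Proof.
move=> /msesP [mf fg _] W h gh; apply: mono_lift => // w.
by apply/fg; rewrite -mcompE gh lf0.
Qed.

Lemma mses_coker X Y Z (f : mhom X Y) (g : mhom Y Z) : mses f g ->
  forall W (h : mhom Y W), mcomp h f = 0 -> exists h', h = mcomp h' g.
Proof.
move=> /msesP [_ fg eg] W h hf; apply: epi_factor => // y /fg [x <-].
by rewrite -mcompE hf lf0.
Qed.

Lemma mmono_ses X Y (f : mhom X Y) : mmono f -> exists Z (g : mhom Y Z), mses f g.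
Proof.
move=> mf.
have [|k u v [x <-] [y <-]|u a [x <-]|N [p [ep pE]]] :=
    @quo_ex Y (fun y => exists x, lf f x = y).
- by exists 0; rewrite linear0.
- by exists (k *: x + y); rewrite linearP.
- by exists (ract x a); rewrite lf_ract.
by exists N, p; apply/msesP.
Qed.

Lemma mepi_ses Y Z (g : mhom Y Z) : mepi g -> exists X (f : mhom X Y), mses f g.
Proof.
move=> eg; have [|k u v gu gv|u a gu|L [i [mi iE]]] := @sub_ex Y (fun y => lf g y = 0).
- by rewrite linear0.
- by rewrite linearP /= gu gv scaler0 addr0.
- by rewrite lf_ract gu ract0l.
by exists L, i; apply/msesP.
Qed.

Lemma mlen_ses X Y Z (f : mhom X Y) (g : mhom Y Z) : mses f g ->
  mlen Y = (mlen X + mlen Z)%N.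
Proof.
move=> [kf fg img]; have := limg_ker_dim (lf g) fullv.
rewrite capfv img -fg /mlen => <-; congr addn.
by have := limg_ker_dim (lf f) fullv; rewrite capfv kf dimv0 add0n.
Qed.

Lemma mlen0 X : mlen X = 0%N <-> mid X = 0.
Proof.
split=> [/eqP|id0].
  rewrite dimv_eq0 => /eqP X0; apply: lf_inj => x; rewrite midE lf0.
  by apply/eqP; rewrite -memv0 -X0 memvf.
apply/eqP; rewrite dimv_eq0 -subv0; apply/subvP => x _.
by rewrite memv0 -(midE x) id0 lf0.
Qed.

(** [W] is the submodule of pairs in the product of [X] and [Z] with equal images in [Y], and [m']
    sends [l] to the pair of [m l] and 0. *)
Lemma mpullback L X Y Z (m : mhom L X) (c : mhom X Y) (g : mhom Z Y) : mses m c ->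
  exists W (q : mhom W X) (p : mhom W Z) (m' : mhom L W),
  [/\ mses m' p, mcomp c q = mcomp g p &
    forall V (h : mhom V X) (h' : mhom V Z), mcomp c h = mcomp g h' ->
      exists w, mcomp q w = h].
Proof.
move=> /msesP [mm mc ec].
have [p1 p1E] := pr1_ex X Z; have [p2 p2E] := pr2_ex X Z.
have [|k u v cu cv|u a cu|W [i [mi iE]]] :=
    @sub_ex (prodmod X Z) (fun u => lf c u.1 = lf g u.2).
- by rewrite !linear0.
- by rewrite /= !linearP /= cu cv.
- by rewrite !lf_ract cu.
have i_inj u v : lf i u = lf i v -> u = v.
  move=> uv; apply/eqP; rewrite -subr_eq0; apply/eqP; move/mmonoP: mi; apply.
  by rewrite raddfB /= uv subrr.
have [j jE] := pair_ex m (0 : mhom L Z).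
have [|m' jm] := mono_lift (h := j) mi.
  move=> l; apply/iE; rewrite jE /= lf0 linear0; apply/mc; by exists l.
have im' l : lf i (lf m' l) = (lf m l, 0).
  by rewrite -mcompE -jm jE lf0.
exists W, (mcomp p1 i), (mcomp p2 i), m'; split.
- apply/msesP; split.
  + apply/mmonoP => l m'l; move/mmonoP: mm; apply.
    by have := congr1 fst (im' l); rewrite m'l linear0 => /= <-.
  + move=> w; rewrite mcompE p2E; split=> [iw2|[l <-]]; last by rewrite im'.
    have /mc [l ml] : lf c (lf i w).1 = 0.
      have -> : lf c (lf i w).1 = lf g (lf i w).2 by apply/iE; exists w.
      by rewrite iw2 linear0.
    by exists l; apply: i_inj; rewrite im' ml -iw2 -surjective_pairing.
  + apply/mepiP => z; move/mepiP: ec => /(_ (lf g z)) [x cx].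
    have [w wE] : exists w, lf i w = (x, z) by apply/iE.
    by exists w; rewrite mcompE p2E wE.
- apply: lf_inj => w; rewrite !mcompE p1E p2E.
  by apply/iE; exists w.
- move=> V h h' e; have [r rE] := pair_ex h h'.
  have [|w rw] := mono_lift (h := r) mi.
    by move=> v; apply/iE; rewrite rE /= -!mcompE e.
  exists w; apply: lf_inj => v.
  by rewrite !mcompE p1E -[X in X.1]mcompE -rw rE.
Qed.

(** [W] is the quotient of the product of [X] and [Z] by the pairs of [m y] and [- g y]; the map
    [c'] is induced by [c] on the first component. *)
Lemma mpushout L X Y Z (c : mhom X L) (m : mhom Y X) (g : mhom Y Z) : mses m c ->
  exists W (q : mhom X W) (p : mhom Z W) (c' : mhom W L),
  [/\ mses p c', mcomp q m = mcomp p g &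
    forall V (h : mhom X V) (h' : mhom Z V), mcomp h m = mcomp h' g ->
      exists w, mcomp w q = h].
Proof.
move=> /msesP [mm mc ec].
have [i1 i1E] := pair_ex (mid X) (0 : mhom X Z).
have [i2 i2E] := pair_ex (0 : mhom Z X) (mid Z).
have [|k u v [x <-] [y <-]|u a [x <-]|W [r [er rE]]] :=
    @quo_ex (prodmod X Z) (fun u => exists y, (lf m y, - lf g y) = u).
- by exists 0; rewrite !linear0.
- by exists (k *: x + y); rewrite !linearP.
- by exists (ract x a); rewrite !lf_ract -ractNl.
have r_eq u v : (exists y, (lf m y, - lf g y) = u - v) -> lf r u = lf r v.
  by move=> /rE; rewrite raddfB => /eqP; rewrite subr_eq0 => /eqP.
have [d dE] := copair_ex c (0 : mhom Z L).
have [|c' dc'] := epi_factor (h := d) er.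
  move=> u /rE [y <-]; rewrite dE /= lf0 addr0; apply/mc; by exists y.
have c'r u : lf c' (lf r u) = lf c u.1.
  by rewrite -mcompE -dc' dE lf0 addr0.
exists W, (mcomp r i1), (mcomp r i2), c'; split.
- apply/msesP; split.
  + apply/mmonoP => z; rewrite mcompE i2E lf0 midE => /rE [y [my gy]].
    move/mmonoP: mm => /(_ _ my) y0.
    by rewrite -gy y0 linear0 oppr0.
  + move=> w; move/mepiP: er => /(_ w) [u <-]; rewrite c'r.
    split=> [/mc [y my]|[z]]; last first.
      by rewrite mcompE => /(congr1 (lf c')); rewrite !c'r i2E lf0 linear0.
    (* When [m y] is the first component of [u], subtracting the relation of [y] moves [u] into the
       second summand. *)
    exists (u.2 + lf g y); rewrite mcompE i2E lf0 midE; apply: r_eq.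
    exists (- y); rewrite !linearN /= opprK my; case: u {my} => a b.
    by apply: injective_projections; rewrite /= ?sub0r // addrAC subrr add0r.
  + apply/mepiP => l; move/mepiP: ec => /(_ l) [x <-].
    by exists (lf r (x, 0)); rewrite c'r.
- apply: lf_inj => y; rewrite !mcompE i1E i2E !midE !lf0; apply: r_eq.
  by exists y; apply: injective_projections; rewrite /= ?subr0 ?sub0r.
- move=> V h h' e; have [t tE] := copair_ex h h'.
  have [|w tw] := epi_factor (h := t) er.
    move=> u /rE [y <-]; rewrite tE /= linearN /=.
    by rewrite -!mcompE e subrr.
  exists w; apply: lf_inj => x.
  by rewrite !mcompE -mcompE -tw tE i1E /= midE !lf0 linear0 addr0.
Qed.
End Modules.

Definition modcat (K : fieldType) (A : falgType K) : abcat K :=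
  @AbCat K (rmod A) (@mhom K A) (@mcomp K A) (@mid K A) (@mmono K A) (@mepi K A)
    (@mses K A) (@mlen K A) (@mcompA K A) (@mcomp1l K A) (@mcomp1r K A)
    (@mcomp_linl K A) (@mcomp_linr K A) (@mmono_cancel K A) (@mepi_cancel K A)
    (@mmono1 K A) (@mepi1 K A) (@mmono_comp K A) (@mepi_comp K A)
    (@mmono_of_comp K A) (@mepi_of_comp K A) (@mimage_factor K A)
    (@mses_mono K A) (@mses_epi K A) (@mses_comp0 K A) (@mses_ker K A)
    (@mses_coker K A) (@mmono_ses K A) (@mepi_ses K A) (@mlen_ses K A)
    (@mlen0 K A) (@mpullback K A) (@mpushout K A).

(** * Simple objects and bricks *)

Section SimpleObjects.
Variables (K : fieldType) (C : abcat K).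
Implicit Types L M N P X Y Z : ob C.

Definition iso_ob X Y : Prop :=
  exists (f : hom X Y) (g : hom Y X), g \oc f = idm X /\ f \oc g = idm Y.

Definition division_ob M : Prop := forall e : hom M M, e <> 0 ->
  exists e', e' \oc e = idm M /\ e \oc e' = idm M.

(** The formulation by short exact sequences is the same condition in [C] and in [op C]. *)
Definition simple_ob M : Prop := len M <> 0%N /\
  forall L N (f : hom L M) (g : hom M N), ses f g -> len L = 0%N \/ len N = 0%N.

(** A nonzero subobject of minimal length is simple. Read in [op C], this yields a simple
    quotient. *)
Lemma simple_ob_sub X : len X <> 0%N -> exists M (f : hom M X), simple_ob M /\ mono f.
Proof.
move=> X0.
pose Q (Mf : {M : ob C & hom M X}) := len (tag Mf) <> 0%N /\ mono (tagged Mf).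
have [|[M f] [/= M0 mf] Mmin] := @ex_min _ Q (fun Mf => len (tag Mf)).
  by exists (Tagged (fun M => hom M X) (idm X)); split=> //=; apply: mono1.
exists M, f; split=> //; split=> // L N a b s.
have [|/eqP L0] := eqVneq (len L) 0%N; first by left.
right; have := Mmin (Tagged (fun M => hom M X) (f \oc a)).
rewrite /= (len_ses s) -{2}[len L]addn0 leq_add2l leqn0 => leN.
by apply/eqP/leN; split=> //=; apply: mono_comp => //; apply: ses_mono s.
Qed.

Lemma simple_ob_epi X M (f : hom X M) : simple_ob M -> f <> 0 -> epi f.
Proof.
move=> [_ simM] f0; have [I [e [m [ee mm fE]]]] := image_factor f.
have [N [c s]] := mono_ses mm; have [|] := simM _ _ _ _ s => /len0 eq0.
  by case: f0; rewrite fE -(comp1l e) eq0 comp0l comp0r.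
have [|h mh] := ses_ker s (h := idm M).
  by rewrite comp1r -(comp1l c) eq0 comp0l.
by rewrite fE; apply: epi_comp => //; apply: (@split_epi _ _ _ _ _ h).
Qed.

Lemma simple_ob_iso M N (f : hom M N) : simple_ob M -> simple_ob N -> f <> 0 ->
  iso_ob M N.
Proof.
move=> simM simN f0; have ef := simple_ob_epi simN f0.
have [L [l s]] := epi_ses ef; case: simM => _ simM.
have [|//] := simM _ _ _ _ s; last by case: simN.
move=> /len0 L0; have [|g gf] := ses_coker s (h := idm M).
  by rewrite comp1l -(comp1r l) L0 comp0r.
exists f, g; split=> //; apply: (epi_inj ef).
by rewrite -compA -gf comp1r comp1l.
Qed.

(** Composing [f] with an isomorphism back to [M] gives a nonzero endomorphism of [M], which is
    invertible. *)
Lemma division_ob_hom M N (f : hom M N) :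
  division_ob M -> iso_ob M N -> f <> 0 ->
  exists g, g \oc f = idm M /\ f \oc g = idm N.
Proof.
move=> divM [u [v [vu uv]]] f0; have [|e' [e'vf vfe']] := divM (v \oc f).
  by move=> vf0; apply: f0; rewrite -(comp1l f) -uv -compA vf0 comp0r.
exists (e' \oc v); split; first by rewrite -compA.
rewrite -(comp1l f) -uv -compA compA -(compA u) -(compA u).
by rewrite (compA (v \oc f)) vfe' comp1l uv.
Qed.

Lemma division_ob_iso M N : division_ob M -> iso_ob M N -> division_ob N.
Proof.
move=> divM isoMN e e0; have [u [v [vu uv]]] := isoMN.
have [|g [gf fg]] := @division_ob_hom _ _ (e \oc u) divM isoMN.
  by move=> eu0; apply: e0; rewrite -(comp1r e) -uv compA eu0 comp0l.
exists (u \oc g); split; last by rewrite compA.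
by rewrite -(comp1r e) -uv -!compA (compA e) (compA g) gf comp1l.
Qed.
End SimpleObjects.

(** * Free and cofree modules *)

Section FreeCofree.
Context {K : fieldType} {A : falgType K}.
Implicit Types L M N X Y Z W : rmod A.

Lemma ract_linear M (x : M) : linear (ract x).
Proof. by move=> k a b; rewrite ractDr ractZr. Qed.

HB.instance Definition _ M (x : M) :=
  GRing.isLinear.Build K A M _ (ract x) (ract_linear x).

Lemma ract_suml M (I : finType) (F : I -> M) a :
  ract (\sum_i F i) a = \sum_i ract (F i) a.
Proof.
by apply: (big_morph (fun x => ract x a)) => [x y|]; rewrite ?ractDl ?ract0l.
Qed.

Definition freemod (m : nat) : rmod A.
Proof.
apply: (@RMod _ _ {ffun 'I_m -> A} (fun f a => [ffun i => f i * a]))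
  => *; apply/ffunP => i; rewrite !ffunE.
- by rewrite mulrDl.
- by rewrite mulrDr.
- by rewrite scalerAl.
- by rewrite scalerAr.
- by rewrite mulrA.
- by rewrite mulr1.
Defined.

Lemma free_hom m Y (y : 'I_m -> Y) :
  exists F : mhom (freemod m) Y, forall f, lf F f = \sum_i ract (y i) ((f : {ffun _}) i).
Proof.
apply: (@mhom_ex _ _ (freemod m) Y (fun f => \sum_i ract (y i) ((f : {ffun _}) i))).
  move=> k f g; rewrite scaler_sumr -big_split; apply: eq_bigr => i _ /=.
  by rewrite !ffunE linearP.
move=> f a; rewrite ract_suml; apply: eq_bigr => i _.
by rewrite ffunE ractM.
Qed.

Lemma freemod_projective m : projective (freemod m : ob (modcat A)).
Proof.
move=> Y Z p g /mepiP ep.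
pose e i : freemod m := [ffun j => (i == j)%:R].
have /fin_all_exists [y yE] := fun i => ep (lf g (e i)).
have [h hE] := free_hom y; exists h; apply: lf_inj => f.
rewrite mcompE hE linear_sum /=.
under eq_bigr => i _ do rewrite lf_ract yE -lf_ract.
rewrite -linear_sum; congr (lf g _).
apply/ffunP => j; rewrite sum_ffunE (bigD1 j) //= big1 => [|i neq_ij].
  by rewrite !ffunE eqxx mul1r addr0.
by rewrite !ffunE (negPf neq_ij) mul0r.
Qed.

Lemma enough_projectives X : exists (P : ob (modcat A)) (e : hom P X),
  epi e /\ projective P.
Proof.
pose b := vbasis {:X}.
have [e eE] := @free_hom (\dim {:X}) X (fun i => b`_i).
exists (freemod (\dim {:X})), e; split; last exact: freemod_projective.
apply/mepiP => x; exists [ffun i => coord b i x *: 1].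
rewrite eE [RHS](coord_vbasis (memvf x)); apply: eq_bigr => i _.
by rewrite ffunE ractZr ract1.
Qed.

(** The coinduced module Hom_K(A, V): left multiplication on the argument gives a right action. *)
Definition cofreemod (V : vectType K) : rmod A.
Proof.
apply: (@RMod _ _ 'Hom(A, V) (fun f a => (f \o amull a)%VF))
  => *; apply/lfunP => b.
all: rewrite ?(add_lfunE, scale_lfunE, comp_lfunE) ?lfunE /=; try by [].
- by rewrite mulrDl linearD.
- by rewrite -scalerAl linearZ.
- by rewrite mulrA.
- by rewrite mul1r.
Defined.

Lemma cofree_hom (V : vectType K) X (f : 'Hom(X, V)) :
  exists F : mhom X (cofreemod V), forall x a, (lf F x : 'Hom(A, V)) a = f (ract x a).
Proof.
pose g x : 'Hom(A, V) := (f \o linfun (ract x))%VF.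
have gE x a : g x a = f (ract x a) by rewrite comp_lfunE lfunE.
have lin_g : linear g.
  move=> k x y; apply/lfunP => a; rewrite add_lfunE scale_lfunE !gE.
  by rewrite ractDl ractZl linearP.
have [|F FE] := @mhom_ex _ _ X (cofreemod V) g lin_g.
  by move=> x a; apply/lfunP => b; rewrite gE [RHS]comp_lfunE gE lfunE /= ractM.
by exists F => x a; rewrite FE gE.
Qed.

(** By the adjunction [cofree_hom] it suffices to extend a [K]-linear map along [f]: the map [g]
    followed by evaluation at 1 is extended by a linear left inverse of [f]. *)
Lemma cofreemod_injective V : projective (cofreemod V : ob (op (modcat A))).
Proof.
move=> Y X f g mf.
have [ev evE] : exists ev : 'Hom('Hom(A, V), V), forall h, ev h = h 1.
  have lin_ev : linear (fun h : 'Hom(A, V) => h 1).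
    by move=> k h h'; rewrite add_lfunE scale_lfunE.
  pose evL : {linear 'Hom(A, V) -> V} :=
    HB.pack (fun h : 'Hom(A, V) => h 1) (GRing.isLinear.Build _ _ _ _ _ lin_ev).
  by exists (linfun evL) => h; rewrite lfunE.
have [F FE] := cofree_hom ((ev \o lf g) \o (lf f)^-1)%VF.
exists F; apply: lf_inj => x; apply/lfunP => a.
have fK : cancel (lf f) (lf f)^-1%VF by apply: lker0_lfunK; apply/eqP.
rewrite mcompE FE -lf_ract !comp_lfunE fK evE.
have -> : lf g (ract x a) = (lf g x \o amull a)%VF := lfP g x a.
by rewrite comp_lfunE lfunE /= mulr1.
Qed.

(** The embedding corresponds to the identity of [X] under the adjunction; evaluation at 1 shows
    that it is injective. *)
Lemma enough_injectives X :
  exists (P : ob (op (modcat A))) (e : @hom _ (op (modcat A)) P X),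
  epi e /\ projective P.
Proof.
have [e eE] := cofree_hom (\1%VF : 'Hom(X, X)).
exists (cofreemod X), e; split; last exact: cofreemod_injective.
apply/mmonoP => x ex0; have := eE x 1.
by rewrite ex0 zero_lfunE id_lfunE ract1.
Qed.
End FreeCofree.

(** * Semibricks of modules *)

Section Semibricks.
Context {K : fieldType} {A : falgType K}.
Implicit Types (L M N X Y Z : rmod A) (D : modclass A) (S : modclass A -> Prop).

(** An injective family in [S] of maximal size exhausts [S], since a missing class could be put in
    front of it. *)
Lemma bounded_has_card S n :
  (forall k (F : 'I_k -> modclass A), (forall i j, F i = F j -> i = j) ->
     (forall i, S (F i)) -> (k <= n)%N) ->
  exists m, has_card S m /\ (m <= n)%N.
Proof.
move=> bound.
pose Q k := exists F : 'I_k -> modclass A,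
  (forall i j, F i = F j -> i = j) /\ forall i, S (F i).
have Q_le k : Q k -> (k <= n)%N by move=> [F [injF SF]]; apply: bound injF SF.
have [|m [F [injF SF]] mmax] := @ex_min _ Q (fun k => n - k)%N.
  exists 0%N, (fun=> fun=> False).
  by split=> -[m lt_m0]; exfalso; rewrite ltn0 in lt_m0.
exists m; split; last by apply: Q_le; exists F.
exists F; split=> // c; split=> [Sc|[i ->]//]; apply: contrapT => cF.
have Qm1 : Q m.+1.
  exists (fun i => oapp F c (unlift ord0 i)); split=> [i j|i]; last first.
    by case: unliftP => [i'|] _ /=; [apply: SF|].
  case: (unliftP ord0 i) => [i'|] ->; case: (unliftP ord0 j) => [j'|] -> //=.
  - by move=> /injF ->.
  - by move=> e; case: cF; exists i'; rewrite e.
  - by move=> e; case: cF; exists j'.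
have := mmax _ Qm1; have := Q_le _ Qm1; lia.
Qed.

Lemma mlen_eq0 M : mlen M = 0%N <-> forall x : M, x = 0.
Proof.
split=> [/eqP|M0].
  by rewrite dimv_eq0 => /eqP M0 x; apply/eqP; rewrite -memv0 -M0 memvf.
by apply/eqP; rewrite dimv_eq0 -subv0; apply/subvP => x _; rewrite (M0 x) mem0v.
Qed.

(** * Torsion classes and approximations in categorical terms *)

Lemma torsionP D : torsion (D : ob (modcat A) -> Prop) <-> torsion_class D.
Proof.
split=> [[D0 Dext Dquo]|[D0 Dext Dquo]]; split.
- by move=> X X0; apply: D0; rewrite /= /mlen X0 dimv0.
- move=> X Y Z f g hf hg kf fg img; apply: (Dext X Y Z (mkhom f) (mkhom g)).
  by split; rewrite !mkhomK.
- move=> X Y g hg img; apply: (Dquo X Y (mkhom g)).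
  by rewrite /= /mepi mkhomK.
- by move=> X /eqP; rewrite dimv_eq0 => /eqP; apply: D0.
- by move=> X Y Z f g [kf fg img]; apply: Dext (lfP f) (lfP g) kf fg img.
- by move=> X Y g; apply: Dquo (lfP g).
Qed.

Lemma torsion_freeP D :
  torsion (D : ob (op (modcat A)) -> Prop) <-> torsion_free_class D.
Proof.
split=> [[D0 Dext Dsub]|[D0 Dext Dsub]]; split.
- by move=> X X0; apply: D0; rewrite /= /mlen X0 dimv0.
- move=> X Y Z f g hf hg kf fg img DX DZ.
  apply: (Dext Z Y X (mkhom g) (mkhom f)) => //.
  by split; rewrite !mkhomK.
- move=> X Y f hf kf; apply: (Dsub Y X (mkhom f)).
  by rewrite /= /mmono mkhomK.
- by move=> X /eqP; rewrite dimv_eq0 => /eqP; apply: D0.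
- move=> Z Y X g f [kf fg img] DZ DX.
  exact: (Dext X Y Z _ _ (lfP f) (lfP g) kf fg img).
- by move=> Y X f; apply: (Dsub _ _ _ (lfP f)).
Qed.

Lemma covariantly_finiteP D : covariantly_finite D ->
  covariantly_finite_in (D : ob (modcat A) -> Prop).
Proof.
move=> fin X; have [Y [f [DY hf fP]]] := fin X.
exists Y, (mkhom f); split=> // Z g DZ; have [h [hh gE]] := fP Z (lf g) DZ (lfP g).
by exists (mkhom h); apply: lf_inj => x; rewrite mcompE !mkhomK // gE comp_lfunE.
Qed.

Lemma contravariantly_finiteP D : contravariantly_finite D ->
  covariantly_finite_in (D : ob (op (modcat A)) -> Prop).
Proof.
move=> fin X; have [Y [f [DY hf fP]]] := fin X.
exists Y, (mkhom f); split=> // Z g DZ; have [h [hh gE]] := fP Z (lf g) DZ (lfP g).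
by exists (mkhom h); apply: lf_inj => x; rewrite mcompE !mkhomK // gE comp_lfunE.
Qed.

(** * Isomorphism classes, simple modules and bricks *)

Lemma isomorphicP M N : isomorphic M N <-> @iso_ob K (modcat A) M N.
Proof.
split=> [[f [g [hf hg gf fg]]]|[f [g [gf fg]]]].
  exists (mkhom f), (mkhom g); split; apply: lf_inj => x.
    by rewrite mcompE midE !mkhomK // -comp_lfunE gf id_lfunE.
  by rewrite mcompE midE !mkhomK // -comp_lfunE fg id_lfunE.
exists (lf f), (lf g); split; [exact: lfP | exact: lfP | | ];
  apply/lfunP => x; rewrite comp_lfunE id_lfunE -mcompE.
  by have -> : mcomp g f = mid M := gf; rewrite midE.
by have -> : mcomp f g = mid N := fg; rewrite midE.
Qed.

Lemma isomorphic_refl M : isomorphic M M.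
Proof.
exists \1%VF, \1%VF; rewrite comp_lfun1l; split=> // x a;
  by rewrite !id_lfunE.
Qed.

Lemma isomorphic_sym M N : isomorphic M N -> isomorphic N M.
Proof. by move=> [f [g [hf hg gf fg]]]; exists g, f. Qed.

Lemma isomorphic_trans L M N : isomorphic L M -> isomorphic M N -> isomorphic L N.
Proof.
move=> /isomorphicP [f [g [gf fg]]] /isomorphicP [f' [g' [gf' fg']]].
apply/isomorphicP; exists (f' \oc f), (g \oc g'); split.
  by rewrite -compA (compA g') gf' comp1l.
by rewrite -compA (compA f) fg comp1l.
Qed.

Lemma isoclassP M N : isoclass M = isoclass N <-> isomorphic M N.
Proof.
split=> [e|MN].
  by have : isoclass N N := isomorphic_refl N; rewrite -e.
apply/funext => X; apply/propext; split; apply: isomorphic_trans => //.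
exact: isomorphic_sym.
Qed.

Lemma simple_moduleP M : simple_module M <-> @simple_ob K (modcat A) M.
Proof.
split=> [[M0 simM]|[M0 simM]]; split.
- by move=> /eqP; rewrite dimv_eq0 => /eqP.
- move=> L N f g s; have dM := len_ses s; case: s => [kf fg img].
  have dL : \dim (limg (lf f)) = mlen L.
    by have := limg_ker_dim (lf f) fullv; rewrite capfv kf dimv0 add0n.
  have [|f0|f1] := simM (limg (lf f)).
  + by move=> _ a /memv_imgP [x _ ->]; rewrite -lf_ract memv_img ?memvf.
  + by left; rewrite /= -dL f0 dimv0.
  + by right; move: dM; rewrite /= {1}/mlen -f1 dL; lia.
- by move=> M00; apply: M0; rewrite /= /mlen M00 dimv0.
move=> U subU; have [i [mi iE]] := submod_ex subU.
have [N [p s]] := @mono_ses _ (modcat A) _ _ i mi.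
have /msesP [_ ip ep] := s.
have [/mlen_eq0 L0|/mlen_eq0 N0] := simM _ _ _ _ s.
- left; apply/eqP; rewrite -subv0; apply/subvP => x /iE [y <-].
  by rewrite (L0 y) linear0 mem0v.
- right; apply/eqP; rewrite eqEsubv subvf; apply/subvP => x _.
  by apply/iE/ip/N0.
Qed.

Lemma brick_division M : brick M -> division_ob (M : ob (modcat A)).
Proof.
move=> [_ divM] e e0; have [|g [hg ge eg]] := divM (lf e) (lfP e).
  by move=> le0; apply: e0; apply: subvs_inj; rewrite [LHS]le0 linear0.
exists (mkhom g); split; apply: lf_inj => x; rewrite mcompE midE mkhomK //.
  by rewrite -comp_lfunE ge id_lfunE.
by rewrite -comp_lfunE eg id_lfunE.
Qed.

Lemma brick_neq0 M : brick M -> @idm K (modcat A) M <> 0.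
Proof.
move=> [M0 _] id0; apply: M0; apply/lfunP => x.
by rewrite id_lfunE zero_lfunE -(midE x) -[mid M]/(@idm K (modcat A) M) id0 lf0.
Qed.

Lemma simple_iso_of_hom M N (f : mhom M N) : simple_module M -> simple_module N ->
  f <> 0 -> isoclass M = isoclass N.
Proof.
move=> /simple_moduleP simM /simple_moduleP simN f0.
by apply/isoclassP/isomorphicP; apply: simple_ob_iso simM simN f0.
Qed.

(** Non-isomorphic simple modules are orthogonal, and each receives a nonzero map from the regular
    module [freemod 1]. Their number is therefore bounded by its dimension, and [xget] returns a
    genuine cardinal. *)
Lemma num_simples_card : has_card (isoclasses (@simple_module K A)) (num_simples A).
Proof.
pose simples := isoclasses (@simple_module K A).
apply: (@xgetPex _ 0%N [set n | has_card simples n]%classic).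
have [|n [hn _]] := @bounded_has_card simples (mlen (@freemod K A 1)); last first.
  by exists n.
move=> k F injF /fin_all_exists2 [M simM FM].
apply: (@independent_len K (modcat A) k M (@freemod K A 1)).
- by move=> i Y f; apply: simple_ob_epi; apply/simple_moduleP.
- move=> i j f neq_ij; apply: contrapT => f0; apply: neq_ij; apply: injF.
  by rewrite !FM; apply: simple_iso_of_hom f0.
- by move=> i /len0; have /simple_moduleP [] := simM i.
move=> i; have /simple_moduleP [Mi0 _] := simM i.
have [x x0] : exists x : M i, x <> 0.
  apply: contrapT => Mi; apply/Mi0/mlen_eq0 => x; apply: contrapT => x0.
  by apply: Mi; exists x.
have [f fE] := @free_hom K A 1 (M i) (fun=> x).
exists f => f0; apply: x0; have := fE [ffun=> 1].
by rewrite f0 lf0 big_ord1 ffunE ract1.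
Qed.

Lemma Tors_torsion_class S : torsion_class (Tors S).
Proof.
split.
- by move=> X X0 D [D0 _ _] _; apply: D0.
- move=> X Y Z f g hf hg kf fg img DX DZ D torD SD; have [_ Dext _] := torD.
  by apply: Dext hf hg kf fg img _ _; [apply: DX | apply: DZ].
- move=> X Y g hg img DX D torD SD; have [_ _ Dquo] := torD.
  by apply: Dquo hg img _; apply: DX.
Qed.

Lemma TorsFree_torsion_free_class S : torsion_free_class (TorsFree S).
Proof.
split.
- by move=> X X0 D [D0 _ _] _; apply: D0.
- move=> X Y Z f g hf hg kf fg img DX DZ D torD SD; have [_ Dext _] := torD.
  by apply: Dext hf hg kf fg img _ _; [apply: DX | apply: DZ].
- move=> X Y g hg img DX D torD SD; have [_ _ Dsub] := torD.
  by apply: Dsub hg img _; apply: DX.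
Qed.

(** [semibrick_bound] is applied in [modcat A] to the torsion class, and in [op (modcat A)] to the
    torsion-free class, where right approximations become left ones and injectives become
    projectives. *)
Lemma semibrick_family_le S k (F : 'I_k -> modclass A) : semibrick S ->
  covariantly_finite (Tors S) \/ contravariantly_finite (TorsFree S) ->
  (forall i j, F i = F j -> i = j) -> (forall i, S (F i)) ->
  (k <= num_simples A)%N.
Proof.
move=> [S_brick S_orth] fin injF SF.
have [simpc [simpc_inj simpcP]] := num_simples_card.
have /fin_all_exists2 [simp simp_simple simpE] :
    forall i, exists2 M, simple_module M & simpc i = isoclass M.
  by move=> i; apply/simpcP; exists i.
have simp_iso M : simple_module M -> exists i, isomorphic (simp i) M.
  move=> simM.
  have /simpcP [i iE] : isoclasses (@simple_module K A) (isoclass M) by exists M.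
  by exists i; apply/isoclassP; rewrite -simpE -iE.
have simp0 i : mlen (simp i) <> 0%N by have /simple_moduleP [] := simp_simple i.
have /fin_all_exists2 [M brM FM] : forall i, exists2 M, brick M & F i = isoclass M.
  by move=> i; apply: S_brick.
pose B M := S (isoclass M).
have BM i : B (M i) by rewrite /B -FM.
have M_orth i j : i <> j -> forall f : mhom (M i) (M j), f = 0.
  move=> neq_ij f; apply: subvs_inj; rewrite [RHS]linear0.
  apply: (S_orth (M i) (M j)); [exact: BM | exact: BM | | exact: lfP].
  by rewrite -!FM => /injF.
have B_brick X : B X -> division_ob (X : ob (modcat A)) /\ @idm K (modcat A) X <> 0.
  move=> /S_brick [N brN /isoclassP /isomorphic_sym /isomorphicP NM].
  split; first exact: division_ob_iso (brick_division brN) NM.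
  move=> id0; apply: (brick_neq0 brN); have [f [g [gf _]]] := NM.
  by rewrite -gf -(comp1r g) id0 comp0r comp0l.
have B_schur X Y (f : @hom K (modcat A) X Y) : B X -> B Y -> f <> 0 ->
    exists g, g \oc f = @idm K (modcat A) X /\ f \oc g = @idm K (modcat A) Y.
  move=> BX BY f0; apply: division_ob_hom => //; first by case: (B_brick _ BX).
  apply/isomorphicP/isoclassP; apply: contrapT => neqXY; apply: f0.
  by apply: subvs_inj; rewrite [RHS]linear0; apply: (S_orth X Y) (lfP f).
have B0 X : B X -> @idm K (modcat A) X <> 0 by case/B_brick.
case: fin => fin.
- apply: (@semibrick_bound K (modcat A) B (Tors S) B_schur B0
    _ _ _ _ _ _ simp _ simp0 k M) => //.
  + exact/torsionP/Tors_torsion_class.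
  + by move=> X BX D _; apply.
  + by move=> D /torsionP torD BD X; apply.
  + exact: covariantly_finiteP.
  + exact: enough_projectives.
  + move=> X X0; have [N [f [/simple_moduleP simN mf]]] := simple_ob_sub X0.
    have [i /isomorphicP [u [v [vu uv]]]] := simp_iso N simN.
    have [|X' [g s]] := @mono_ses _ (modcat A) _ _ (f \oc u).
      apply: mono_comp => //; apply: (@mono_of_comp _ _ _ _ _ v).
      by rewrite vu; apply: mono1.
    by exists i, X', (f \oc u), g.
  + by move=> i j f /M_orth.
- apply: (@semibrick_bound K (op (modcat A)) B (TorsFree S) _ B0
    _ _ _ _ _ _ simp _ simp0 k M) => //.
  + move=> X Y f BX BY f0; have [g [gf fg]] := B_schur _ _ f BY BX f0.
    by exists g.
  + exact/torsion_freeP/TorsFree_torsion_free_class.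
  + by move=> X BX D _; apply.
  + by move=> D /torsion_freeP torD BD X; apply.
  + exact: contravariantly_finiteP.
  + exact: enough_injectives.
  + move=> X X0; have [N [f [simN ef]]] := @simple_ob_sub K (op (modcat A)) X X0.
    have simN' : simple_module N.
      apply/simple_moduleP; split; first by case: simN.
      by move=> L Q a b s; have [_ simN2] := simN; have [] := simN2 _ _ _ _ s; [right|left].
    have [i /isomorphicP [u [v [vu uv]]]] := simp_iso N simN'.
    have [|X' [g s]] := @epi_ses _ (modcat A) _ _ (v \oc f).
      apply: epi_comp => //; apply: (@epi_of_comp _ _ _ _ _ _ u).
      by rewrite vu; apply: epi1.
    by exists i, X', (v \oc f), g.
  + by move=> i j f neq_ij; apply: M_orth => e; apply: neq_ij.
Qed.
End Semibricks.

Local Close Scope ring_scope.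

Theorem corollary0p2 (K : fieldType) (A : falgType K)
    (S : modclass A -> Prop) :
  semibrick S -> left_finite S \/ right_finite S ->
  exists m : nat, has_card S m /\ m <= num_simples A.
Proof.
(* Bounding all finite families of distinct classes in [S] gives the finiteness of [S] together with
   the bound. *)
move=> semiS fin; apply: bounded_has_card => k F injF SF.
apply: (semibrick_family_le semiS _ injF SF).
by case: fin => -[contra cov]; [left|right].
Qed.
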